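(* Let $k$ be an algebraically closed field, $d\geqslant 1$ an integer, and let $\mathcal{T}$ be a $k$-linear $\operatorname{Hom}$-finite $(d+2)$-angulated category with split idempotents, with $d$-suspension functor $\Sigma^d$ and with a Serre functor $S$. Let $T\in\mathcal{T}$ be an object which is cluster tilting in the sense of Oppermann–Thomas, let $\Gamma=\operatorname{End}_{\mathcal{T}}T$, and assume that $\mathcal{T}$ has finitely many indecomposable objects up to isomorphism. Then: (i) $\Gamma$ is weakly $d$-representation finite. (ii) If $\Gamma$ has finite global dimension, then it is $d$-representation finite.
   Context: **$(d+2)$-angulated categories** (Geiss–Keller–Oppermann). Let $\mathcal{T}$ be an additive category with an automorphism $\Sigma^d$ (the $d$-suspension; the symbol is a single functor), and put $n=d+2$. An $n$-$\Sigma^d$-sequence is a sequence of morphisms $X_1\xrightarrow{\alpha_1}X_2\xrightarrow{\alpha_2}\cdots\xrightarrow{\alpha_{n-1}}X_n\xrightarrow{\alpha_n}\Sigma^dX_1$. Its left rotation is $X_2\xrightarrow{\alpha_2}\cdots\xrightarrow{\alpha_n}\Sigma^dX_1\xrightarrow{(-1)^n\Sigma^d\alpha_1}\Sigma^dX_2$. A morphism to another such sequence $(Y_i,\beta_i)$ is a tuple $\varphi_i:X_i\to Y_i$, $1\leqslant i\leqslant n$, commuting with the structure maps (using $\Sigma^d\varphi_1$ at the last place). $\mathcal{T}$ is $(d+2)$-angulated if it is equipped with a class of $n$-$\Sigma^d$-sequences, called $(d+2)$-angles, closed under isomorphism, such that: (F1) (a) the class is closed under direct sums and direct summands; (b) for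 each $X$ the trivial sequence $X\xrightarrow{1_X}X\to 0\to\cdots\to 0\to\Sigma^dX$ is a $(d+2)$-angle; (c) each morphism $\alpha_1:X_1\to X_2$ is the first morphism of a $(d+2)$-angle. (F2) A sequence is a $(d+2)$-angle if and only if its left rotation is. (F3) Given two $(d+2)$-angles $(X_i,\alpha_i)$, $(Y_i,\beta_i)$ and $\varphi_1,\varphi_2$ with $\varphi_2\alpha_1=\beta_1\varphi_1$, there are $\varphi_3,\ldots,\varphi_n$ completing them to a morphism of sequences. (F4) In (F3) the $\varphi_3,\ldots,\varphi_n$ can be chosen so that the cone $X_2\oplus Y_1\to X_3\oplus Y_2\to\cdots\to\Sigma^dX_1\oplus Y_n\to\Sigma^dX_2\oplus\Sigma^dY_1$, with maps $\begin{pmatrix}-\alpha_i&0\\ \varphi_i&\beta_{i-1}\end{pmatrix}$ for $2\leqslant i\leqslant n$ and last map $\begin{pmatrix}-\Sigma^d\alpha_1&0\\ \Sigma^d\varphi_1&\beta_n\end{pmatrix}$, is a $(d+2)$-angle. **Conventions.** $\mathcal{T}(X,Y)$ denotes the morphism space. A Serre functor is an autoequivalence $S$ of $\mathcal{T}$ with natural isomorphisms $D\mathcal{T}(X,Y)\cong\mathcal{T}(Y,SX)$, where $D=\operatorname{Hom}_k(-,k)$. $\operatorname{mod}\Gamma$ is the category of finite dimensional right $\Gamma$-modules. $\operatorname{add}$ of an object is the full subcategory of direct summands of finite direct sums of copies of that object. **Cluster tilting in the sense of Oppermann–Thomas.** $T$ is cluster tilting in this sense if: (i) $\mathcal{T}(T,\Sigma^dT)=0$;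 and (ii) each $X\in\mathcal{T}$ occurs in a $(d+2)$-angle $T_d\to T_{d-1}\to\cdots\to T_1\to T_0\to X\to\Sigma^dT_d$ with $T_i\in\operatorname{add}T$ for $0\leqslant i\leqslant d$. **$d$-cluster tilting modules and (weakly) $d$-representation finite algebras.** A full subcategory $\mathcal{X}\subseteq\operatorname{mod}\Gamma$ is $d$-cluster tilting if it is functorially finite in $\operatorname{mod}\Gamma$ and $\mathcal{X}=\{X\in\operatorname{mod}\Gamma\mid\operatorname{Ext}^i_\Gamma(X,\mathcal{X})=0\text{ for }1\leqslant i\leqslant d-1\}=\{X\in\operatorname{mod}\Gamma\mid\operatorname{Ext}^i_\Gamma(\mathcal{X},X)=0\text{ for }1\leqslant i\leqslant d-1\}$. A module $M\in\operatorname{mod}\Gamma$ is $d$-cluster tilting if $\operatorname{add}M$ is a $d$-cluster tilting subcategory. The finite dimensional algebra $\Gamma$ is weakly $d$-representation finite if there is a $d$-cluster tilting module in $\operatorname{mod}\Gamma$; it is $d$-representation finite if moreover its global dimension is at most $d$. *)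

(* Defs.v *)
From HB Require Import structures.
From mathcomp Require Import all_boot all_order all_algebra.

Set Implicit Arguments.
Unset Strict Implicit.
Unset Printing Implicit Defensive.

Import GRing.Theory.
Local Open Scope ring_scope.

(* Hom-finiteness is built in: a [vectType k] is a finite dimensional space. *)
Record linCat (k : fieldType) := LinCat {
  obj :> Type;
  hom : obj -> obj -> vectType k;
  idm : forall X, hom X X;
  comp : forall X Y Z, hom Y Z -> hom X Y -> hom X Z;
  compA : forall W X Y Z (h : hom Y Z) (g : hom X Y) (f : hom W X),
    comp h (comp g f) = comp (comp h g) f;
  comp1m : forall X Y (f : hom X Y), comp (idm Y) f = f;
  compm1 : forall X Y (f : hom X Y), comp f (idm X) = f;
  comp_linearl : forall X Y Z (f : hom X Y), linear (fun g : hom Y Z => comp g f);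
  comp_linearr : forall X Y Z (g : hom Y Z), linear (fun f : hom X Y => comp g f)
}.

Arguments hom {k l} X Y : rename.
Arguments idm {k l} X : rename.
Arguments comp {k l X Y Z} g f : rename.

Notation "g \oc f" := (comp g f) (at level 40, left associativity).

Section LinCatTheory.
Variables (k : fieldType) (C : linCat k).

Definition is_iso (X Y : C) (f : hom X Y) : Prop :=
  exists g : hom Y X, g \oc f = idm X /\ f \oc g = idm Y.

Definition isomorphic (X Y : C) : Prop := exists f : hom X Y, is_iso f.

Definition idempotents_split : Prop :=
  forall (X : C) (e : hom X X), e \oc e = e ->
  exists (Y : C) (r : hom X Y) (s : hom Y X), r \oc s = idm Y /\ s \oc r = e.

Record arrow := Arrow { arr_src : C; arr_tgt : C; arr_mor : hom arr_src arr_tgt }.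

End LinCatTheory.

(* Not assumed linear: functors between the underlying ordinary categories. *)
Record functor (k : fieldType) (C D : linCat k) := Functor {
  fobj :> C -> D;
  fmap : forall X Y : C, hom X Y -> hom (fobj X) (fobj Y);
  fmap_id : forall X, fmap (idm X) = idm (fobj X);
  fmap_comp : forall (X Y Z : C) (g : hom Y Z) (f : hom X Y),
    fmap (g \oc f) = fmap g \oc fmap f
}.

Arguments fmap {k C D} F {X Y} f : rename.

Section Functors.
Variables (k : fieldType) (C : linCat k).
Implicit Types F G : functor C C.

(* Equality of functors is equality of the induced maps on arrows, so [G] is a
   strict two-sided inverse of [F]. *)
Definition is_automorphism F : Prop :=
  exists G, (forall (X Y : C) (f : hom X Y), Arrow (fmap G (fmap F f)) = Arrow f)
         /\ (forall (X Y : C) (f : hom X Y), Arrow (fmap F (fmap G f)) = Arrow f).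

Definition is_autoequivalence F : Prop :=
  exists G,
    (exists eta : forall X : C, hom (G (F X)) X, (forall X, is_iso (eta X)) /\
       forall (X Y : C) (f : hom X Y), f \oc eta X = eta Y \oc fmap G (fmap F f))
    /\
    (exists eps : forall X : C, hom (F (G X)) X, (forall X, is_iso (eps X)) /\
       forall (X Y : C) (f : hom X Y), f \oc eps X = eps Y \oc fmap F (fmap G f)).

(* [theta] is the inverse of the isomorphism D(X,Y) ~ (Y,SX), which lets both
   naturality conditions be stated on elements. *)
Definition serre_functor (S : functor C C) : Prop :=
  is_autoequivalence S /\
  exists theta : forall X Y : C, {linear hom Y (S X) -> 'Hom(hom X Y, k^o)},
    [/\ forall X Y, bijective (theta X Y),
        forall (X X' Y : C) (f : hom X X') (u : hom Y (S X)) (g : hom X' Y),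
          theta X' Y (fmap S f \oc u) g = theta X Y u (g \oc f)
      & forall (X Y Y' : C) (h : hom Y' Y) (u : hom Y (S X)) (g : hom X Y'),
          theta X Y' (u \oc h) g = theta X Y u (h \oc g)].

End Functors.

Record addCat (k : fieldType) := AddCat {
  addCat_lin :> linCat k;
  zobj : addCat_lin;
  zobj_initial : forall (X : addCat_lin) (f : hom zobj X), f = 0;
  zobj_terminal : forall (X : addCat_lin) (f : hom X zobj), f = 0;
  dsum : addCat_lin -> addCat_lin -> addCat_lin;
  in1 : forall X Y, hom X (dsum X Y);
  in2 : forall X Y, hom Y (dsum X Y);
  pr1 : forall X Y, hom (dsum X Y) X;
  pr2 : forall X Y, hom (dsum X Y) Y;
  pr1_in1 : forall X Y, pr1 X Y \oc in1 X Y = idm X;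
  pr2_in2 : forall X Y, pr2 X Y \oc in2 X Y = idm Y;
  pr1_in2 : forall X Y, pr1 X Y \oc in2 X Y = 0;
  pr2_in1 : forall X Y, pr2 X Y \oc in1 X Y = 0;
  in_pr : forall X Y,
    in1 X Y \oc pr1 X Y + in2 X Y \oc pr2 X Y = idm (dsum X Y)
}.

Arguments zobj {k C} : rename.
Arguments dsum {k C} X Y : rename.
Arguments in1 {k C X Y} : rename.
Arguments in2 {k C X Y} : rename.
Arguments pr1 {k C X Y} : rename.
Arguments pr2 {k C X Y} : rename.

Section Additive.
Variables (k : fieldType) (C : addCat k).
Implicit Types X Y Z : C.

Definition dsum_copies (n : nat) X : C := iter n (dsum X) zobj.

Definition in_add (T X : C) : Prop :=
  exists n Y, isomorphic (dsum X Y) (dsum_copies n T).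

Definition indecomposable X : Prop :=
  ~ isomorphic X zobj /\
  forall Y Z, isomorphic X (dsum Y Z) -> isomorphic Y zobj \/ isomorphic Z zobj.

Definition finitely_many_indecomposables : Prop :=
  exists n (M : 'I_n -> C),
    forall X, indecomposable X -> exists i, isomorphic X (M i).

(* The matrix ((a, b), (c, e)) acting on columns. *)
Definition mx22 X Y X' Y' (a : hom X X') (b : hom Y X') (c : hom X Y')
    (e : hom Y Y') : hom (dsum X Y) (dsum X' Y') :=
  in1 \oc a \oc pr1 + in1 \oc b \oc pr2 + in2 \oc c \oc pr1 + in2 \oc e \oc pr2.

(* [chain n X Y] is the type of sequences X -> Z_1 -> ... -> Z_n -> Y. *)
Fixpoint chain (n : nat) (X Y : C) : Type :=
  if n is m.+1 then {Z : C & (hom X Z * chain m Z Y)%type} else hom X Y.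

Definition ccons n X Z Y (f : hom X Z) (c : chain n Z Y) : chain n.+1 X Y :=
  existT _ Z (f, c).

Definition chd n X Y (c : chain n.+1 X Y) : C := projT1 c.
Definition cfst n X Y (c : chain n.+1 X Y) : hom X (chd c) := (projT2 c).1.
Definition ctl n X Y (c : chain n.+1 X Y) : chain n (chd c) Y := (projT2 c).2.

(* Appends [g] as a new last arrow. *)
Fixpoint crcons n : forall X Y Z, chain n X Y -> hom Y Z -> chain n.+1 X Z :=
  match n with
  | 0 => fun X Y Z c g => @ccons 0 _ _ _ c g
  | m.+1 => fun X Y Z c g => ccons (cfst c) (crcons (ctl c) g)
  end.

(* Replaces the last arrow [f] by [g \oc f]. *)
Fixpoint cpost n : forall X Y Z, chain n X Y -> hom Y Z -> chain n X Z :=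
  match n with
  | 0 => fun X Y Z c g => g \oc c
  | m.+1 => fun X Y Z c g => ccons (cfst c) (cpost (ctl c) g)
  end.

Fixpoint czero n : forall X Y, chain n X Y :=
  match n with
  | 0 => fun X Y => 0
  | m.+1 => fun X Y => @ccons m _ zobj _ 0 (czero m zobj Y)
  end.

Fixpoint csum n : forall X Y X' Y',
    chain n X Y -> chain n X' Y' -> chain n (dsum X X') (dsum Y Y') :=
  match n with
  | 0 => fun X Y X' Y' c c' => mx22 c 0 0 c'
  | m.+1 => fun X Y X' Y' c c' =>
      ccons (mx22 (cfst c) 0 0 (cfst c')) (csum (ctl c) (ctl c'))
  end.

(* The families of morphisms between the intermediate objects of [c] and [c']
   which, together with [u] and [v] at the two ends, form a commutative ladder. *)
Fixpoint cmap n : forall X Y X' Y',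
    chain n X Y -> chain n X' Y' -> hom X X' -> hom Y Y' -> Type :=
  match n with
  | 0 => fun X Y X' Y' c c' u v => v \oc c = c' \oc u
  | m.+1 => fun X Y X' Y' c c' u v =>
      {w : hom (chd c) (chd c') &
        ((w \oc cfst c = cfst c' \oc u) * cmap (ctl c) (ctl c') w v)%type}
  end.

Fixpoint cmap_iso n : forall X Y X' Y' (c : chain n X Y) (c' : chain n X' Y')
    (u : hom X X') (v : hom Y Y'), cmap c c' u v -> Prop :=
  match n with
  | 0 => fun X Y X' Y' c c' u v phi => True
  | m.+1 => fun X Y X' Y' c c' u v phi =>
      is_iso (projT1 phi) /\ cmap_iso (projT2 phi).2
  end.

(* For c = (X_1 -a_1-> ... -> X_(n+1) -a_(n+1)-> E), b = b_0 : Y_0 -> Y_1,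
   c' = (Y_1 -b_1-> ... -> Y_(n+1) -b_(n+1)-> F), phi_i : X_i -> Y_i,
   v : E -> F and g : E -> G this is the sequence
     X_1 (+) Y_0 -> ... -> X_(n+1) (+) Y_n -> E (+) Y_(n+1) -> G (+) F
   with maps ((- a_i, 0), (phi_i, b_(i-1))) and last map
   ((- g, 0), (v, b_(n+1))). *)
Fixpoint ccone n : forall X E Y0 Y F G (c : chain n X E) (b : hom Y0 Y)
    (c' : chain n Y F) (u : hom X Y) (v : hom E F) (g : hom E G),
    cmap c c' u v -> chain n.+1 (dsum X Y0) (dsum G F) :=
  match n with
  | 0 => fun X E Y0 Y F G c b c' u v g phi =>
      @ccons 0 _ (dsum E Y) _ (mx22 (- c) 0 u b) (mx22 (- g) 0 v c')
  | m.+1 => fun X E Y0 Y F G c b c' u v g phi =>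
      ccons (mx22 (- cfst c) 0 u b) (ccone (cfst c') g (projT2 phi).2)
  end.

End Additive.

Section Sequences.
Variables (k : fieldType) (C : addCat k) (Sg : functor C C) (d : nat).

(* The sequences X_1 -> X_2 -> ... -> X_(d+2) -> Sg X_1. *)
Definition sgseq (X : C) : Type := chain d.+1 X (Sg X).

Definition sgseq_iso X Y (c : sgseq X) (c' : sgseq Y) : Prop :=
  exists (u : hom X Y) (phi : cmap c c' u (fmap Sg u)), is_iso u /\ cmap_iso phi.

Definition susp_dsum (X Y : C) : hom (dsum (Sg X) (Sg Y)) (Sg (dsum X Y)) :=
  fmap Sg in1 \oc pr1 + fmap Sg in2 \oc pr2.

Definition sgseq_sum X Y (c : sgseq X) (c' : sgseq Y) : sgseq (dsum X Y) :=
  cpost (csum c c') (susp_dsum X Y).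

Definition sgseq_trivial (X : C) : sgseq X := ccons (idm X) (czero d X (Sg X)).

Definition sgseq_rot X1 X2 (a : hom X1 X2) (c : chain d X2 (Sg X1)) : sgseq X2 :=
  crcons c ((-1) ^+ d.+2 *: fmap Sg a).

Definition sgseq_cone X1 X2 Y1 Y2 (a : hom X1 X2) (c : chain d X2 (Sg X1))
    (b : hom Y1 Y2) (c' : chain d Y2 (Sg Y1)) (u1 : hom X1 Y1) (u2 : hom X2 Y2)
    (phi : cmap c c' u2 (fmap Sg u1)) : sgseq (dsum X2 Y1) :=
  cpost (ccone b (fmap Sg a) phi) (susp_dsum X2 Y1).

End Sequences.

Record angCat (k : fieldType) (d : nat) := AngCat {
  angCat_add :> addCat k;
  susp : functor angCat_add angCat_add;
  susp_linear : forall X Y : angCat_add, linear (fun f : hom X Y => fmap susp f);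
  susp_automorphism : is_automorphism susp;
  angle : forall X : angCat_add, sgseq susp d X -> Prop;
  angle_iso : forall X Y (c : sgseq susp d X) (c' : sgseq susp d Y),
    sgseq_iso c c' -> angle c -> angle c';
  angle_sum : forall X Y (c : sgseq susp d X) (c' : sgseq susp d Y),
    angle (sgseq_sum c c') <-> angle c /\ angle c';
  angle_trivial : forall X, angle (sgseq_trivial susp d X);
  angle_exists : forall X1 X2 (a : hom X1 X2),
    exists c : chain d X2 (susp X1), @angle X1 (ccons a c);
  angle_rot : forall X1 X2 (a : hom X1 X2) (c : chain d X2 (susp X1)),
    @angle X1 (ccons a c) <-> angle (sgseq_rot a c);
  angle_map : forall X1 X2 (a : hom X1 X2) (c : chain d X2 (susp X1))
      Y1 Y2 (b : hom Y1 Y2) (c' : chain d Y2 (susp Y1))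
      (u1 : hom X1 Y1) (u2 : hom X2 Y2),
    @angle X1 (ccons a c) -> @angle Y1 (ccons b c') -> u2 \oc a = b \oc u1 ->
    inhabited (cmap c c' u2 (fmap susp u1));
  angle_cone : forall X1 X2 (a : hom X1 X2) (c : chain d X2 (susp X1))
      Y1 Y2 (b : hom Y1 Y2) (c' : chain d Y2 (susp Y1))
      (u1 : hom X1 Y1) (u2 : hom X2 Y2),
    @angle X1 (ccons a c) -> @angle Y1 (ccons b c') -> u2 \oc a = b \oc u1 ->
    exists phi : cmap c c' u2 (fmap susp u1), angle (sgseq_cone a b phi)
}.

Arguments susp {k d} C : rename.
Arguments angle {k d C X} c : rename.

Section ClusterTilting.
Variables (k : fieldType) (d : nat) (C : angCat k d).

(* In A -> Z_1 -> ... -> Z_(n+1) -> E the objects Z_1, ..., Z_n are in add T,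
   and Z_(n+1) is X. *)
Fixpoint add_resolves (T X : C) n : forall A E : C, chain n.+1 A E -> Prop :=
  match n with
  | 0 => fun A E c => chd c = X
  | m.+1 => fun A E c => in_add T (chd c) /\ add_resolves T X (ctl c)
  end.

(* Cluster tilting in the sense of Oppermann-Thomas. *)
Definition cluster_tilting (T : C) : Prop :=
  (forall f : hom T (susp C T), f = 0) /\
  forall X : C, exists (Td : C) (c : sgseq (susp C) d Td),
    [/\ angle c, in_add T Td & add_resolves T X c].

End ClusterTilting.

(* A finite dimensional k-algebra, given as a ring with a central map from k.
   [falgType] excludes the zero algebra, which is the endomorphism algebra of a
   zero object. *)
Record fdAlgebra (k : fieldType) := FdAlgebra {
  fdalg_ring :> pzRingType;
  fdalg_scalar : {rmorphism k -> fdalg_ring};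
  fdalg_central : forall c a, fdalg_scalar c * a = a * fdalg_scalar c;
  fdalg_fin_dim : exists n (s : 'I_n -> fdalg_ring), forall a,
    exists c : 'I_n -> k, a = \sum_(i < n) fdalg_scalar (c i) * s i
}.

Arguments fdalg_scalar {k} A : rename.

Definition endo (k : fieldType) (C : linCat k) (X : C) : Type := hom X X.

Section Endo.
Variables (k : fieldType) (C : linCat k) (X : C).

HB.instance Definition _ := GRing.Zmodule.copy (endo X) (hom X X).

Definition endo_mul (f g : endo X) : endo X := comp (f : hom X X) g.

Fact endo_mulA : associative endo_mul.
Proof. by move=> f g h; apply: compA. Qed.
Fact endo_mul1l : left_id (idm X : endo X) endo_mul.
Proof. by move=> f; apply: comp1m. Qed.
Fact endo_mul1r : right_id (idm X : endo X) endo_mul.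
Proof. by move=> f; apply: compm1. Qed.
Fact endo_mulDl : left_distributive endo_mul +%R.
Proof.
by move=> f g h; have := comp_linearl (h : hom X X) 1 f g; rewrite !scale1r.
Qed.
Fact endo_mulDr : right_distributive endo_mul +%R.
Proof.
by move=> f g h; have := comp_linearr (f : hom X X) 1 g h; rewrite !scale1r.
Qed.

HB.instance Definition _ := GRing.Zmodule_isPzRing.Build (endo X)
  endo_mulA endo_mul1l endo_mul1r endo_mulDl endo_mulDr.

Fact comp_scalel (c : k) (f g : hom X X) : (c *: f) \oc g = c *: (f \oc g).
Proof.
have L := @comp_linearl k C X X X g; have := L c f 0.
by have := L (-1) 0 0; rewrite !scaleN1r !addNr => ->; rewrite !addr0.
Qed.
Fact comp_scaler (c : k) (f g : hom X X) : f \oc (c *: g) = c *: (f \oc g).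
Proof.
have L := @comp_linearr k C X X X f; have := L c g 0.
by have := L (-1) 0 0; rewrite !scaleN1r !addNr => ->; rewrite !addr0.
Qed.

Definition endo_scalar (c : k) : endo X := c *: idm X.

Fact endo_scalarM (c : k) (f : endo X) :
  endo_scalar c * f = (c *: (f : hom X X) : hom X X).
Proof.
by rewrite -[f in RHS](@comp1m _ _ _ _ (f : hom X X)) -comp_scalel.
Qed.
Fact endo_scalar_central (c : k) (f : endo X) :
  endo_scalar c * f = f * endo_scalar c.
Proof.
rewrite endo_scalarM -[f in LHS](@compm1 _ _ _ _ (f : hom X X)).
by rewrite -comp_scaler.
Qed.
Fact endo_scalar_zmod : zmod_morphism endo_scalar.
Proof. by move=> a b; apply: scalerBl. Qed.
Fact endo_scalar_monoid : monoid_morphism endo_scalar.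
Proof.
split; first exact: scale1r.
by move=> a b; rewrite endo_scalarM /endo_scalar scalerA.
Qed.

HB.instance Definition _ := GRing.isZmodMorphism.Build k (endo X)
  endo_scalar endo_scalar_zmod.
HB.instance Definition _ := GRing.isMonoidMorphism.Build k (endo X)
  endo_scalar endo_scalar_monoid.

Fact endo_fin_dim : exists n (s : 'I_n -> endo X), forall f,
  exists c : 'I_n -> k, f = \sum_(i < n) endo_scalar (c i) * s i.
Proof.
pose b := vbasis {:hom X X}.
exists (\dim {:hom X X}), (fun i => b`_i : hom X X) => f.
exists (fun i => coord b i (f : hom X X)).
rewrite {1}(coord_vbasis (memvf (f : hom X X))).
by apply: eq_bigr => i _; rewrite endo_scalarM.
Qed.

(* The product of f and g is f \oc g. *)
Definition endoAlg : fdAlgebra k :=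
  @FdAlgebra k (endo X) endo_scalar endo_scalar_central endo_fin_dim.

End Endo.

Section Modules.
Variables (k : fieldType) (A : fdAlgebra k).

(* Right A-modules are left modules over the converse ring; [k] acts through
   [fdalg_scalar A]. *)
Definition fin_dim (M : lmodType A^c) : Prop :=
  exists n (s : 'I_n -> M), forall m, exists c : 'I_n -> k,
    m = \sum_(i < n) (fdalg_scalar A (c i) : A^c) *: s i.

Record fdmod := FdMod {
  fdmod_sort :> lmodType A^c;
  fdmod_fin_dim : fin_dim fdmod_sort
}.

Implicit Types L M N P U V : fdmod.

Definition projective P : Prop :=
  forall M N (g : {linear M -> N}) (f : {linear P -> N}),
    (forall y, exists x, g x = y) ->
    exists h : {linear P -> M}, forall x, g (h x) = f x.

Record proj_resolution M := ProjResolution {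
  pr_obj : nat -> fdmod;
  pr_diff : forall i, {linear pr_obj i.+1 -> pr_obj i};
  pr_aug : {linear pr_obj 0 -> M};
  pr_projective : forall i, projective (pr_obj i);
  pr_surj : forall m, exists x, pr_aug x = m;
  pr_exact0 : forall x, pr_aug x = 0 <-> exists y, pr_diff 0 y = x;
  pr_exact : forall i x, pr_diff i x = 0 <-> exists y, pr_diff i.+1 y = x
}.

(* Ext^i(M, N) = 0, i.e., Hom(P, N) has no cohomology in degree i for a
   projective resolution P of M.  M has such resolutions, as A is finite
   dimensional, and the condition holds for all of them or for none. *)
Definition Ext_eq0 (i : nat) M N : Prop :=
  if i is j.+1 then
    forall (P : proj_resolution M) (f : {linear pr_obj P j.+1 -> N}),
      (forall x, f (pr_diff P j.+1 x) = 0) ->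
      exists g : {linear pr_obj P j -> N}, forall x, f x = g (pr_diff P j x)
  else forall f : {linear M -> N}, forall x, f x = 0.

Definition proj_dim_le (n : nat) M : Prop :=
  exists P : proj_resolution M, forall i, (n < i)%N -> forall x : pr_obj P i, x = 0.

(* Measured on finite dimensional right modules; for a finite dimensional
   algebra this is the global dimension computed on all modules. *)
Definition gldim_le (n : nat) : Prop := forall M, proj_dim_le n M.

Definition gldim_finite : Prop := exists n, gldim_le n.

Definition in_add_mod M U : Prop :=
  exists n V (f : {linear (U * V)%type -> {ffun 'I_n -> M}}), bijective f.

(* Full subcategories of mod A are given by predicates on objects. *)
Definition contravariantly_finite (X : fdmod -> Prop) : Prop :=
  forall M, exists U (f : {linear U -> M}), X U /\
    forall V (g : {linear V -> M}), X V ->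
    exists h : {linear V -> U}, forall v, g v = f (h v).

Definition covariantly_finite (X : fdmod -> Prop) : Prop :=
  forall M, exists U (f : {linear M -> U}), X U /\
    forall V (g : {linear M -> V}), X V ->
    exists h : {linear U -> V}, forall m, g m = h (f m).

Definition functorially_finite (X : fdmod -> Prop) : Prop :=
  contravariantly_finite X /\ covariantly_finite X.

Definition cluster_tilting_subcat (d : nat) (X : fdmod -> Prop) : Prop :=
  [/\ functorially_finite X,
      forall M, X M <->
        (forall N i, X N -> (1 <= i <= d - 1)%N -> Ext_eq0 i M N)
    & forall M, X M <->
        (forall N i, X N -> (1 <= i <= d - 1)%N -> Ext_eq0 i N M)].

Definition cluster_tilting_module (d : nat) M : Prop :=
  cluster_tilting_subcat d (in_add_mod M).

Definition weakly_rep_finite (d : nat) : Prop :=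
  exists M, cluster_tilting_module d M.

Definition rep_finite (d : nat) : Prop :=
  weakly_rep_finite d /\ gldim_le d.

End Modules.

Arguments gldim_finite {k} A.
Arguments weakly_rep_finite {k} A d.
Arguments rep_finite {k} A d.

(* Main.v *)
Require Import Defs.
From HB Require Import structures.
From mathcomp Require Import all_boot all_order all_algebra.
From Stdlib Require Import Classical ClassicalEpsilon Eqdep.
(* The library of linear maps also defines [hom]. *)
Import Defs.

(** Write F = T(T, -). Angles are exact for all covariant and contravariant Hom
    functors, and T(T, Sigma^d T) = 0.

    Ext^i(FX, FY) = 0 for 1 <= i <= d-1: write Y = S Y'. Serre duality turns the
    resolution T_d -> ... -> T_0 -> Sigma^d Y' into a coresolution
    FY -> F(S T_d) -> ... -> F(S T_0), whose terms F(S T_i) are injective since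
    F(S T) is the dual of Gamma, and Hom(FX, -) is exact on it.

    Let N be any module. An angle starting with a morphism in add T that presents
    N yields an exact sequence 0 -> N -> FX_3 -> ... -> FX_(d+2) -> 0. If
    Ext^i(FX, N) = 0 for all X and 1 <= i <= d-1, all its maps split, starting from
    the right, so that N is in add F. An angle ending in a morphism of add S T that
    copresents N yields 0 -> FX_1 -> ... -> FX_d -> N -> 0, which splits if the
    groups Ext^i(N, FX) vanish. As there are finitely many indecomposables, the FX
    lie in the add of a single module.

    For S Y' = T the coresolution above continues to an injective coresolution of
    Gamma of length d. Hence Ext^n(-, Gamma) = 0 for n > d, and then a projective
    resolution of finite length n > d splits at its left end and can be shortened. *)

Set Implicit Arguments.
Unset Strict Implicit.
Unset Printing Implicit Defensive.

Import GRing.Theory.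
Local Open Scope ring_scope.

(** * Linear and additive categories *)

Section LinearCategory.
Variables (k : fieldType) (C : linCat k).
Implicit Types X Y Z W : C.

Lemma compDl X Y Z (g g' : hom Y Z) (f : hom X Y) :
  (g + g') \oc f = g \oc f + g' \oc f.
Proof. by have := @comp_linearl k C X Y Z f 1 g g'; rewrite !scale1r. Qed.

Lemma compDr X Y Z (g : hom Y Z) (f f' : hom X Y) :
  g \oc (f + f') = g \oc f + g \oc f'.
Proof. by have := @comp_linearr k C X Y Z g 1 f f'; rewrite !scale1r. Qed.

Lemma comp0l X Y Z (f : hom X Y) : (0 : hom Y Z) \oc f = 0.
Proof.
by have := compDl (0 : hom Y Z) 0 f; rewrite addr0 -{1}[_ \oc _]addr0 => /addrI.
Qed.

Lemma comp0r X Y Z (g : hom Y Z) : g \oc (0 : hom X Y) = 0.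
Proof.
by have := compDr g (0 : hom X Y) 0; rewrite addr0 -{1}[_ \oc _]addr0 => /addrI.
Qed.

Lemma compZl (a : k) X Y Z (g : hom Y Z) (f : hom X Y) :
  (a *: g) \oc f = a *: (g \oc f).
Proof. by have := @comp_linearl k C X Y Z f a g 0; rewrite !addr0 comp0l addr0. Qed.

Lemma compZr (a : k) X Y Z (g : hom Y Z) (f : hom X Y) :
  g \oc (a *: f) = a *: (g \oc f).
Proof. by have := @comp_linearr k C X Y Z g a f 0; rewrite !addr0 comp0r addr0. Qed.

Lemma comp_suml I (r : seq I) (P : pred I) X Y Z (g : I -> hom Y Z)
    (f : hom X Y) :
  (\sum_(i <- r | P i) g i) \oc f = \sum_(i <- r | P i) (g i \oc f).
Proof.
by apply: (big_morph (fun g => g \oc f)) => [? ?|]; rewrite ?compDl ?comp0l.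
Qed.

Lemma comp_sumr I (r : seq I) (P : pred I) X Y Z (g : hom Y Z)
    (f : I -> hom X Y) :
  g \oc (\sum_(i <- r | P i) f i) = \sum_(i <- r | P i) (g \oc f i).
Proof.
by apply: (big_morph (fun f => g \oc f)) => [? ?|]; rewrite ?compDr ?comp0r.
Qed.

Lemma Arrow_inj X Y (f g : hom X Y) : Arrow f = Arrow g -> f = g.
Proof. by move=> e; injection e => e1; move: (inj_pair2 _ _ _ _ _ (inj_pair2 _ _ _ _ _ e1)). Qed.

(** [f] is a weak kernel of [g] and [g] a weak cokernel of [f], so that every covariant and every
    contravariant Hom functor is exact at [Y]. *)
Definition cexact X Y Z (f : hom X Y) (g : hom Y Z) : Prop :=
  [/\ g \oc f = 0,
      forall W (h : hom W Y), g \oc h = 0 -> exists h', h = f \oc h'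
    & forall W (h : hom Y W), h \oc f = 0 -> exists h', h = h' \oc g].

(** Membership of [Y] in the add of [X], written with matrix entries only, so that every additive
    functor transports it at once. *)
Definition gen X Y : Prop :=
  exists n (p : 'I_n -> hom X Y) (q : 'I_n -> hom Y X),
    \sum_i p i \oc q i = idm Y.

Definition retract X Y : Prop :=
  exists (p : hom X Y) (i : hom Y X), p \oc i = idm Y.

Lemma retract_gen X Y : retract X Y -> gen X Y.
Proof. by case=> p [q e]; exists 1, (fun=> p), (fun=> q); rewrite big_ord1. Qed.

Lemma gen_refl X : gen X X.
Proof. by apply: retract_gen; exists (idm X), (idm X); rewrite comp1m. Qed.

Lemma isomorphic_sym X Y : isomorphic X Y -> isomorphic Y X.
Proof. by case=> f [g [e1 e2]]; exists g, f. Qed.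

Lemma isomorphic_retract X Y : isomorphic X Y -> retract X Y.
Proof. by case=> f [g [e1 e2]]; exists f, g. Qed.

Lemma gen_trans X Y Z : gen X Y -> gen Y Z -> gen X Z.
Proof.
move=> [n [p [q e]]] [n' [p' [q' e']]].
pose I := ('I_n' * 'I_n)%type.
exists #|{: I}|, (fun i => let ij := enum_val i in p' ij.1 \oc p ij.2),
  (fun i => let ij := enum_val i in q ij.2 \oc q' ij.1).
rewrite -(big_enum_val (op := +%R) (fun ij : I =>
   (p' ij.1 \oc p ij.2) \oc (q ij.2 \oc q' ij.1)) (A := {: I})) /=.
rewrite (eq_bigl xpredT) => [|//].
rewrite -(pair_big xpredT xpredT
  (fun i j => (p' i \oc p j) \oc (q j \oc q' i))) /= -e'.
apply: eq_bigr => i _; transitivity (p' i \oc ((\sum_j p j \oc q j) \oc q' i)).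
  rewrite comp_suml comp_sumr; apply: eq_bigr => j _.
  by rewrite !compA.
by rewrite e comp1m.
Qed.

End LinearCategory.

Section AdditiveCategory.
Variables (k : fieldType) (C : addCat k).
Implicit Types X Y Z W : C.

Lemma idm_zobj : idm (zobj : C) = 0.
Proof. exact: zobj_initial. Qed.

Lemma isomorphic_zobj X : idm X = 0 -> isomorphic X zobj.
Proof.
move=> e; exists 0, 0; split; first by rewrite comp0r e.
by rewrite comp0r idm_zobj.
Qed.

Lemma gen_dsum T X Y : gen T X -> gen T Y -> gen T (dsum X Y).
Proof.
move=> [n [p [q e]]] [n' [p' [q' e']]].
exists (n + n')%N,
  (fun i => match split i with inl j => in1 \oc p j | inr j => in2 \oc p' j end),
  (fun i => match split i with inl j => q j \oc pr1 | inr j => q' j \oc pr2 end).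
rewrite big_split_ord /= -in_pr; congr (_ + _).
  rewrite -[in1 in RHS]compm1 -e comp_sumr comp_suml; apply: eq_bigr => i _.
  by rewrite (unsplitK (inl i)) !compA.
rewrite -[in2 in RHS]compm1 -e' comp_sumr comp_suml; apply: eq_bigr => i _.
by rewrite (unsplitK (inr i)) !compA.
Qed.

Lemma gen_zobj T : gen T (zobj : C).
Proof.
by exists 0, (fun=> 0), (fun=> 0); rewrite big_ord0 idm_zobj.
Qed.

Lemma dsum_copies_biprod (T : C) n :
  exists (p : 'I_n -> hom T (dsum_copies n T)) (q : 'I_n -> hom (dsum_copies n T) T),
    \sum_i p i \oc q i = idm _ /\
    (forall i j, q i \oc p j = if i == j then idm T else 0).
Proof.
elim: n => [|n [p [q [e dl]]]].
  exists (fun=> 0), (fun=> 0); rewrite big_ord0 idm_zobj.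
  by split=> // -[].
exists (fun i => if unlift ord0 i is Some j then in2 \oc p j else in1),
  (fun i => if unlift ord0 i is Some j then q j \oc pr2 else pr1).
split.
  rewrite big_ord_recl /= unlift_none -in_pr; congr (_ + _).
  rewrite -[in2 in RHS]compm1 -e comp_sumr comp_suml; apply: eq_bigr => i _.
  by rewrite liftK !compA.
move=> i j; case: (unliftP ord0 i) => [i' ->|->];
  case: (unliftP ord0 j) => [j' ->|->].
- by rewrite (inj_eq lift_inj) -dl !compA -(compA (q i')) pr2_in2 compm1.
- by rewrite -compA pr2_in1 comp0r.
- by rewrite compA pr1_in2 comp0l.
- by rewrite eqxx pr1_in1.
Qed.

Lemma gen_copies (T : C) n : gen T (dsum_copies n T).
Proof. by have [p [q [e _]]] := dsum_copies_biprod T n; exists n, p, q. Qed.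

Lemma in_add_gen (T V : C) : in_add T V -> gen T V.
Proof.
move=> [n [Y /isomorphic_sym iso]].
apply: gen_trans (gen_copies T n) _; apply: retract_gen.
case: iso => f [g [e1 e2]]; exists (pr1 \oc f), (g \oc in1).
by rewrite compA -(compA pr1) e2 compm1 pr1_in1.
Qed.

(** [X0] is the direct sum of the representatives [M i]. An object that is neither zero nor
    indecomposable splits into two nonzero summands, and induction on the dimension of its
    endomorphism space applies to both. *)
Lemma finite_type_gen : finitely_many_indecomposables C ->
  exists X0 : C, forall X, gen X0 X.
Proof.
move=> [n [M indM]].
have [X0 retX0] : exists X0, forall i, retract X0 (M i).
  elim: n M {indM} => [|n IH] M; first by exists zobj => -[].
  have [X1 r1] := IH (fun i => M (lift ord0 i)).
  exists (dsum (M ord0) X1) => i; case: (unliftP ord0 i) => [j|] ->.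
    case: (r1 j) => p [q e]; exists (p \oc pr2), (in2 \oc q).
    by rewrite compA -(compA p) pr2_in2 compm1.
  by exists pr1, in1; rewrite pr1_in1.
exists X0 => X.
have [m] := ubnP (\dim {:hom X X}); elim: m X => // m IH X.
rewrite ltnS => dX.
have [X00|X_neq0] := classic (isomorphic X zobj).
  apply: gen_trans (gen_zobj _) _.
  exact/retract_gen/isomorphic_retract/isomorphic_sym.
have [indX|] := classic (indecomposable X).
  case: (indM _ indX) => i /isomorphic_sym /isomorphic_retract iso.
  exact: gen_trans (retract_gen (retX0 i)) (retract_gen iso).
move=> /not_and_or [//|] /not_all_ex_not [Y] /not_all_ex_not [Z].
move=> nXYZ; have [isoX nYZ] := imply_to_and _ _ nXYZ; have [Y0 Z0] := not_or_and _ _ nYZ.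
(* Extension by zero embeds the endomorphisms of [Y'] into those of [X], and its image misses the
   nonzero idempotent [j \oc q], because [p \oc j = 0]. *)
suff ht : forall Y' Z' (i : hom Y' X) (p : hom X Y') (j : hom Z' X) (q : hom X Z'),
    p \oc i = idm _ -> q \oc j = idm _ -> p \oc j = 0 -> ~ isomorphic Z' zobj ->
    (\dim {:hom Y' Y'} < \dim {:hom X X})%N.
  have iso' := isomorphic_retract (isomorphic_sym isoX).
  apply: gen_trans (retract_gen iso').
  case: isoX => f [g [e1 e2]].
  have E A B (p : hom (dsum Y Z) A) (i : hom B (dsum Y Z)) :
      (p \oc f) \oc (g \oc i) = p \oc i.
    by rewrite compA -(compA p) e2 compm1.
  apply: gen_dsum.
    apply: IH; apply: leq_trans dX.
    by apply: (ht Y Z (g \oc in1) (pr1 \oc f) (g \oc in2) (pr2 \oc f));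
      rewrite ?E ?pr1_in1 ?pr2_in2 ?pr1_in2.
  apply: IH; apply: leq_trans dX.
  by apply: (ht Z Y (g \oc in2) (pr2 \oc f) (g \oc in1) (pr1 \oc f));
    rewrite ?E ?pr1_in1 ?pr2_in2 ?pr2_in1.
move=> Y' Z' i p j q pi qj pj Z'0.
pose h (f : hom Y' Y') : hom X X := (i \oc f) \oc p.
have hlin : linear h.
  by move=> a f f'; rewrite /h compDr compZr compDl compZl.
pose hl : {linear hom Y' Y' -> hom X X} := HB.pack h (GRing.isLinear.Build _ _ _ _ h hlin).
have hK f : p \oc (h f \oc i) = f.
  by rewrite /h -!compA pi compm1 compA pi comp1m.
have k0 : lker (linfun hl) == 0%VS.
  apply/lker0P => f f'; rewrite !lfunE /= => e.
  by rewrite -(hK f) -(hK f') e.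
have <- : \dim (linfun hl @: fullv) = \dim {:hom Y' Y'}.
  by apply: limg_dim_eq; rewrite (eqP k0) capv0.
rewrite (ltn_leqif (dimv_leqif_sup (subvf _))).
apply/negP => /subvP /(_ (j \oc q) (memvf _)) /memv_imgP [f _].
rewrite lfunE /= => e; apply: Z'0; apply: isomorphic_zobj.
have f0 : f = 0 by rewrite -(hK f) -e !compA pj !comp0l.
have jq0 : j \oc q = 0 by rewrite e f0 /h comp0r comp0l.
by rewrite -qj -[j]compm1 -qj !compA -(compA q) jq0 comp0r comp0l.
Qed.

End AdditiveCategory.

(** * Exactness of angles *)

Section Chains.
Variables (k : fieldType) (C : addCat k).
Implicit Types X Y Z W : C.

Definition composable_pred :=
  forall X Y Z : C, hom X Y -> hom Y Z -> Prop.

Variable R : composable_pred.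

(* [R] holds for the arrows in positions [i] and [i.+1] (counted from 0). *)
Fixpoint pair_at (i n : nat) X Y : chain n X Y -> Prop :=
  match n, i with
  | 0, _ => fun _ => True
  | m.+1, 0 => match m return chain m.+1 X Y -> Prop with
               | 0 => fun c => R (cfst c) (ctl c)
               | _.+1 => fun c => R (cfst c) (cfst (ctl c))
               end
  | m.+1, j.+1 => fun c => pair_at j (ctl c)
  end.

Fixpoint all_pairs (n : nat) W X Y (a : hom W X) : chain n X Y -> Prop :=
  match n with
  | 0 => fun c => R a c
  | m.+1 => fun c => R a (cfst c) /\ all_pairs (cfst c) (ctl c)
  end.

Lemma pair_at_rcons i n X Y Z (c : chain n X Y) (g : hom Y Z) :
  pair_at i (crcons c g) -> pair_at i c.
Proof.
elim: n i X Y Z c g => [|n IH] [|i] X Y Z c g //=; last exact: IH.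
by case: n {IH} c.
Qed.

Lemma pair_at_all n W X Y (a : hom W X) (c : chain n X Y) :
  (forall i, pair_at i (@ccons _ _ n _ _ _ a c)) -> all_pairs a c.
Proof.
elim: n W X Y a c => [|n IH] W X Y a c H; first exact: (H 0).
split; first exact: (H 0).
apply: IH => i; have := H i.+1; by case: c {H} => ? [].
Qed.

End Chains.

Section ChainMaps.
Variables (k : fieldType) (C : addCat k).
Implicit Types X Y Z W : C.

Lemma cmap_rcons_last n X Y Z X' Y' Z' (c : chain n X Y) (g : hom Y Z)
    (c' : chain n X' Y') (g' : hom Y' Z') (u : hom X X') (v : hom Z Z') :
  cmap (crcons c g) (crcons c' g') u v -> exists w, v \oc g = g' \oc w.
Proof.
elim: n X Y Z X' Y' Z' c g c' g' u v => [|n IH] X Y Z X' Y' Z' c g c' g' u v /=.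
  by case=> w [_ e]; exists w.
by case=> w [_]; apply: IH.
Qed.

Lemma cmap_czero_rcons n W Z V (g : hom Z V) (v : hom V V) :
  idm Z = 0 -> g = 0 ->
  exists phi : cmap (czero n.+1 W V) (crcons (czero n W Z) g) (idm W) v,
    cmap_iso phi.
Proof.
move=> Z0 ->; elim: n W => [|n IH] W.
  have [f [h [fh hf]]] := isomorphic_sym (isomorphic_zobj Z0).
  have e1 : f \oc (0 : hom W zobj) = 0 \oc idm W by rewrite comp0r comp0l.
  have e2 : v \oc (0 : hom zobj V) = 0 \oc f by rewrite comp0r comp0l.
  exists (existT _ f (e1, e2)); split=> //; first by exists h.
have [phi isophi] := IH zobj.
have e1 : idm zobj \oc (0 : hom W zobj) = 0 \oc idm W by rewrite comp0r comp0l.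
exists (existT _ (idm zobj) (e1, phi)); split=> //=.
by exists (idm zobj); rewrite comp1m.
Qed.

End ChainMaps.

Section Angles.
Variables (k : fieldType) (d : nat) (C : angCat k d).
Implicit Types X Y Z W : C.
Local Notation Sg := (susp C).

Lemma suspD X Y (f g : hom X Y) : fmap Sg (f + g) = fmap Sg f + fmap Sg g.
Proof. by have := susp_linear 1 f g; rewrite !scale1r. Qed.

Lemma susp0 X Y : fmap Sg (0 : hom X Y) = 0.
Proof.
by have := suspD (0 : hom X Y) 0; rewrite addr0 -{1}[fmap _ _]addr0 => /addrI.
Qed.

Lemma susp_idm_zobj : idm (Sg zobj) = 0.
Proof. by rewrite -fmap_id idm_zobj susp0. Qed.

Lemma susp_faithful X Y (f g : hom X Y) : fmap Sg f = fmap Sg g -> f = g.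
Proof.
have [G [GF _]] := susp_automorphism C => e.
by apply: Arrow_inj; rewrite -GF e GF.
Qed.

Lemma susp_full X Y (g : hom (Sg X) (Sg Y)) : exists f, g = fmap Sg f.
Proof.
have [G [GF FG]] := susp_automorphism C.
have GFobj Z : fobj G (Sg Z) = Z by have /(congr1 (@arr_src _ _)) := GF _ _ (idm Z).
(* The equation [fobj G (Sg Z) = Z] is only propositional, so the endpoints are generalised to
   variables that it can eliminate. *)
suff gen_obj : forall A B (h : hom A B), A = X -> B = Y ->
    Arrow (fmap Sg h) = Arrow g -> exists f : hom X Y, g = fmap Sg f.
  exact: gen_obj (GFobj X) (GFobj Y) (FG _ _ g).
move=> A B h eA eB; subst A B => /Arrow_inj <-; by exists h.
Qed.

Lemma susp_surj X : exists Y, Sg Y = X.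
Proof.
have [G [_ FG]] := susp_automorphism C.
by exists (G X); have /(congr1 (@arr_src _ _)) := FG _ _ (idm X).
Qed.

End Angles.

(* From here on the paper's d is written d.+1, as d >= 1. *)
Section AngleExactness.
Variables (k : fieldType) (d : nat) (C : angCat k d.+1).
Implicit Types X Y Z W : C.
Local Notation Sg := (susp C).

(** Its rotation is isomorphic to the trivial angle on [W]: the object [Sg zobj] is zero, though not
    known to equal [zobj]. *)
Lemma angle_zero_id W :
  angle (@ccons _ C d.+1 zobj W (Sg zobj) 0
          (@ccons _ C d W W (Sg zobj) (idm W) (czero d W (Sg zobj)))).
Proof.
apply/angle_rot; apply: angle_iso (angle_trivial W).
have g0 : (-1) ^+ d.+3 *: fmap Sg (0 : hom zobj W) = 0 by rewrite susp0 scaler0.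
have [phi isophi] := cmap_czero_rcons d W (fmap Sg (idm W)) (susp_idm_zobj C) g0.
have e : idm W \oc idm W = idm W \oc idm W by [].
exists (idm W), (existT _ (idm W) (e, phi)).
by split=> //=; [|split=> //]; exists (idm W); rewrite comp1m.
Qed.

(** Each clause is one use of the morphism axiom: from the trivial angle on [X1]; from the rotated
    trivial angle on [W] to the rotated angle, where the last component is a suspension and the
    signs cancel; and to the angle $0 \to W \to W$. *)
Lemma angle_cexact X1 X2 X3 (a : hom X1 X2) (b : hom X2 X3)
    (c : chain d X3 (Sg X1)) :
  angle (@ccons _ C d.+1 X1 X2 (Sg X1) a (@ccons _ C d X2 X3 (Sg X1) b c)) ->
  cexact a b.
Proof.
move=> ang; split.
- have e : a \oc idm X1 = a \oc idm X1 by [].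
  have [[w [/= <- _]]] := angle_map (angle_trivial X1) ang e.
  by rewrite comp0r.
- move=> W h bh0.
  have /angle_rot r1 := angle_trivial W; have /angle_rot r2 := ang.
  have e : (0 : hom zobj X3) \oc (0 : hom W zobj) = b \oc h.
    by rewrite comp0l bh0.
  have [/cmap_rcons_last [w]] := angle_map r1 r2 e.
  have [h' ->] := susp_full w.
  rewrite fmap_id compZr compm1 compZl -fmap_comp => e'.
  exists h'; apply: (@susp_faithful _ _ C).
  have s0 : ((-1) ^+ d.+3 : k) != 0 by rewrite signr_eq0.
  exact: (scalerI s0).
move=> W h ha0.
have e : h \oc a = (0 : hom zobj W) \oc (0 : hom X1 zobj).
  by rewrite comp0l ha0.
have [[w [/= e' _]]] := angle_map ang (angle_zero_id W) e.
by exists w; rewrite e' comp1m.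
Qed.

(** Rotation moves every pair of arrows one place to the left, so each pair reaches the front, where
    [angle_cexact] applies. *)
Lemma angle_pair_at i X (c : sgseq Sg d.+1 X) :
  angle c -> pair_at (@cexact k C) i c.
Proof.
elim: i X c => [|i IH] X [X2 [a c]].
  by case: c => X3 [b c] /angle_cexact.
by move=> /angle_rot /IH /pair_at_rcons.
Qed.

(** The arrow appended by the rotation makes exactness at [Sg X1] part of the statement. *)
Lemma angle_all_pairs X1 X2 (a : hom X1 X2) (c : chain d.+1 X2 (Sg X1)) :
  @angle _ _ _ X1 (@ccons _ C d.+1 _ _ _ a c) ->
  all_pairs (@cexact k C) a (crcons c ((-1) ^+ d.+3 *: fmap Sg a)).
Proof.
move=> ang; apply: pair_at_all => -[|i].
  by case: c ang => X3 [b c]; apply: angle_cexact.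
exact: (@angle_pair_at i X2 _ ((angle_rot a c).1 ang)).
Qed.

Lemma cexactZr (s : k) X Y Z (f : hom X Y) (g : hom Y Z) :
  s != 0 -> cexact f (s *: g) -> cexact f g.
Proof.
move=> s0 [e1 e2 e3].
have eg : g = s^-1 *: (s *: g) by rewrite scalerA mulVf // scale1r.
split.
- by rewrite eg compZl e1 scaler0.
- by move=> W h gh; apply: e2; rewrite compZl gh scaler0.
- by move=> W h /e3 [h' ->]; exists (s *: h'); rewrite compZl compZr.
Qed.

End AngleExactness.

(** * Finite dimensional modules *)

Section Subspaces.
Variables (k : fieldType) (V : vectType k).

(** A largest subspace inside [P] is all of [P], since adjoining a missing vector raises the
    dimension. *)
Lemma subspace_vspace (P : V -> Prop) : P 0 ->
  (forall a u v, P u -> P v -> P (a *: u + v)) ->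
  exists U : {vspace V}, forall v, v \in U <-> P v.
Proof.
move=> P0 PD.
suff H m (U : {vspace V}) : (\dim {:V} - \dim U < m)%N -> (forall v, v \in U -> P v) ->
    exists U' : {vspace V}, forall v, v \in U' <-> P v.
  by apply: (H _ 0%VS (ltnSn _)) => v /[!memv0] /eqP ->.
elim: m U => // m IH U dU PU.
have [[v [Pv vU]]|allU] := classic (exists v, P v /\ v \notin U).
  apply: (IH (U + <[v]>)%VS).
    rewrite -ltnS; apply: leq_trans dU; rewrite ltnS; apply: ltn_sub2l.
      rewrite (ltn_leqif (dimv_leqif_sup (subvf U))).
      by apply: contra vU => /subvP; apply; apply: memvf.
    rewrite (ltn_leqif (dimv_leqif_sup (addvSl U _))).
    apply: contra vU => /subvP; apply.
    exact: (subvP (addvSr U _)) (memv_line v).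
  move=> w /memv_addP [u uU [v' /vlineP [c ->] ->]].
  by rewrite addrC; apply: PD => //; apply: PU.
exists U => v; split; first exact: PU.
by move=> Pv; apply: NNPP => vU; apply: allU; exists v; split=> //; apply/negP.
Qed.

(** Two preimages under [D] differ by an element of its kernel, which [f] kills. So [f] composed
    with the linear map [D^-1] is a factor of [f] through [D], defined on all of [W]. *)
Lemma lfun_factor (W U : vectType k) (D : 'Hom(V, W)) (f : 'Hom(V, U)) :
  (forall v, D v = 0 -> f v = 0) -> forall v, f (D^-1%VF (D v)) = f v.
Proof.
move=> H v; apply/eqP; rewrite -subr_eq0 -linearB; apply/eqP/H.
by rewrite linearB /= limg_lfunVK ?subrr // memv_img ?memvf.
Qed.

End Subspaces.

Section LinearMaps.
Variables (R : pzRingType).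
Implicit Types M N L : lmodType R.

Definition mklin M N (f : M -> N) (fl : linear f) : {linear M -> N} :=
  HB.pack f (GRing.isLinear.Build _ _ _ _ f fl).

Lemma linear_sum_exists M N n (f : 'I_n -> {linear M -> N}) :
  exists g : {linear M -> N}, forall x, g x = \sum_i f i x.
Proof.
have gl : linear (fun x => \sum_i f i x).
  move=> a x y; rewrite scaler_sumr -big_split; apply: eq_bigr => i _.
  by rewrite linearP.
by exists (mklin gl).
Qed.

Lemma linear_factor_surj M N L (p : {linear M -> N}) (f : {linear M -> L}) :
  (forall y, exists x, p x = y) -> (forall x, p x = 0 -> f x = 0) ->
  exists g : {linear N -> L}, forall x, g (p x) = f x.
Proof.
move=> psurj pf.
pose s y := proj1_sig (constructive_indefinite_description _ (psurj y)).
have sK y : p (s y) = y by rewrite /s; case: constructive_indefinite_description.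
have fE x y : p x = p y -> f x = f y.
  move=> e; apply/eqP; rewrite -subr_eq0 -linearB; apply/eqP/pf.
  by rewrite linearB e subrr.
have gl : linear (fun y => f (s y)).
  by move=> a x y; rewrite -linearP; apply: fE; rewrite linearP !sK.
by exists (mklin gl) => x; apply: fE; rewrite sK.
Qed.

Lemma linear_factor_inj M N L (i : {linear N -> M}) (f : {linear L -> M}) :
  (forall y, i y = 0 -> y = 0) -> (forall x, exists y, i y = f x) ->
  exists g : {linear L -> N}, forall x, i (g x) = f x.
Proof.
move=> iinj fi.
pose g x := proj1_sig (constructive_indefinite_description _ (fi x)).
have gK x : i (g x) = f x by rewrite /g; case: constructive_indefinite_description.
have gl : linear g.
  move=> a x y; apply/eqP; rewrite -subr_eq0; apply/eqP/iinj.
  by rewrite linearB linearP !gK linearP subrr.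
by exists (mklin gl).
Qed.

End LinearMaps.

Section KernelModule.
Variables (R : pzRingType) (M N : lmodType R) (g : {linear M -> N}).

Definition ker_pred : pred M := fun x => g x == 0.

Fact ker_submod_closed : submod_closed ker_pred.
Proof.
split=> [|a x y]; rewrite !unfold_in ?linear0 // linearP.
by move=> /eqP -> /eqP ->; rewrite scaler0 addr0.
Qed.

HB.instance Definition _ := GRing.isSubmodClosed.Build R M ker_pred ker_submod_closed.

Record ker_type := KerElt { ker_val :> M; ker_valP : ker_val \in ker_pred }.

HB.instance Definition _ := [isSub for ker_val].
HB.instance Definition _ := [Choice of ker_type by <:].
HB.instance Definition _ := [SubChoice_isSubLmodule of ker_type by <:].

Lemma ker_val0 (x : ker_type) : g (ker_val x) = 0.
Proof. exact/eqP/ker_valP. Qed.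

Lemma ker_val_onto x : g x = 0 -> exists y : ker_type, ker_val y = x.
Proof. by move=> /eqP gx; exists (KerElt gx). Qed.

Definition ker_incl : {linear ker_type -> M} := val.

End KernelModule.

(** * Linear algebra over [k] inside finite dimensional modules *)

Section Coordinates.
Variables (k : fieldType) (A : fdAlgebra k).
Implicit Types M N : fdmod A.

Definition kact (M : lmodType A^c) (c : k) (x : M) : M :=
  (fdalg_scalar A c : A^c) *: x.

Local Notation "c *k x" := (kact c x) (at level 40).

Lemma kact_lin (M N : lmodType A^c) (f : {linear M -> N}) c x y :
  f (c *k x + y) = c *k f x + f y.
Proof. exact: linearP. Qed.

Definition klinear (M : lmodType A^c) (V : lmodType k) (f : M -> V) :=
  forall c x y, f (c *k x + y) = c *: f x + f y.

Lemma klinear0 (M : lmodType A^c) (V : lmodType k) (f : M -> V) :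
  klinear f -> f 0 = 0.
Proof.
move=> fl; have := fl (-1) 0 0; rewrite /kact scaler0 add0r scaleN1r.
by rewrite addNr.
Qed.

Lemma kactDl (M : lmodType A^c) c c' (x : M) : (c + c') *k x = c *k x + c' *k x.
Proof. by rewrite /kact rmorphD; apply: (@scalerDl A^c). Qed.

Lemma kact0l (M : lmodType A^c) (x : M) : 0 *k x = 0.
Proof. by rewrite /kact rmorph0; apply: (@scale0r A^c). Qed.

Lemma kactA (M : lmodType A^c) c c' (x : M) : c *k (c' *k x) = (c * c') *k x.
Proof. by rewrite /kact scalerA mulrC rmorphM. Qed.

Lemma kact_swap (M : lmodType A^c) c (a : A^c) (x : M) : c *k (a *: x) = a *: (c *k x).
Proof.
rewrite /kact !scalerA; congr (_ *: _).
by rewrite -[LHS]/((a : A) * fdalg_scalar A c) -fdalg_central.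
Qed.

Lemma klinearD (M : lmodType A^c) (V : lmodType k) (f : M -> V) x y :
  klinear f -> f (x + y) = f x + f y.
Proof. by move=> /(_ 1 x y); rewrite /kact rmorph1 !scale1r. Qed.

Lemma kpi_sum (M : lmodType A^c) (V : lmodType k) (pi : V -> M) n
  (c : 'I_n -> k) (s : 'I_n -> V) :
  (forall c u v, pi (c *: u + v) = c *k pi u + pi v) -> pi 0 = 0 ->
  pi (\sum_i c i *: s i) = \sum_i c i *k pi (s i).
Proof.
move=> pil pi0; elim: n c s => [|n IH] c s; first by rewrite !big_ord0.
by rewrite big_ord_recl pil IH big_ord_recl.
Qed.

(** [M] becomes a linear retract of a row space. The map [pi] comes from a spanning family; removing
    from a preimage its projection to the kernel of [pi] makes it independent of choices, hence
    linear. *)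
Lemma coordinates M :
  exists n (phi : M -> 'rV[k]_n) (pi : 'rV[k]_n -> M),
    [/\ klinear phi, forall c u v, pi (c *: u + v) = c *k pi u + pi v
      & cancel phi pi].
Proof.
have [n [s sP]] := fdmod_fin_dim M.
pose pi (v : 'rV[k]_n) := \sum_i v 0 i *k s i.
have pil c u v : pi (c *: u + v) = c *k pi u + pi v.
  rewrite /pi /kact scaler_sumr -big_split /=; apply: eq_bigr => i _.
  by rewrite !mxE -/(kact _ _) kactDl -kactA.
have pi0 : pi 0 = 0.
  by rewrite /pi big1 // => i _; rewrite mxE kact0l.
have piB u v : pi (u - v) = pi u - pi v.
  have -> : u - v = -1 *: v + u by rewrite scaleN1r addrC.
  rewrite pil /kact rmorphN1 addrC; congr (_ + _).
  exact: (@scaleN1r A^c).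
have [|c u v|U UP] := @subspace_vspace _ _ (fun v => pi v = 0) => //.
  by rewrite pil => -> ->; rewrite /kact scaler0 addr0.
have piS x : exists v, pi v = x.
  have [c ->] := sP x; exists (\row_i c i).
  by apply: eq_bigr => i _; rewrite mxE.
pose f x := proj1_sig (constructive_indefinite_description _ (piS x)).
have fK x : pi (f x) = x by rewrite /f; case: constructive_indefinite_description.
pose pr v := v - projv U v.
have prE u v : pi u = pi v -> pr u = pr v.
  move=> e; have /projv_id : u - v \in U by apply/UP; rewrite piB e subrr.
  rewrite linearB /= => e'; apply/eqP; rewrite -subr_eq0 /pr.
  by rewrite opprD addrACA -opprD e' subrr.
exists n, (fun x => pr (f x)), pi; split=> //.
- move=> c x y.
  rewrite (prE _ (c *: f x + f y)); last by rewrite pil !fK.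
  by rewrite /pr linearP /= scalerBr opprD addrACA.
- by move=> x; rewrite /pr piB fK (UP _).1 ?subr0 // memv_proj.
Qed.

Definition submodule (M : lmodType A^c) (P : M -> Prop) :=
  P 0 /\ forall a x y, P x -> P y -> P (a *: x + y).

Lemma submodule_span M (P : M -> Prop) : submodule P ->
  exists n (s : 'I_n -> M), (forall i, P (s i)) /\
    forall x, P x -> exists c : 'I_n -> k, x = \sum_i c i *k s i.
Proof.
move=> [P0 PD]; have [n [phi [pi [phil pil phiK]]]] := coordinates M.
have pi0 : pi 0 = 0.
  by rewrite -(klinear0 phil) phiK.
have [||U UP] := @subspace_vspace _ _ (fun v => P (pi v)).
- by rewrite pi0.
- by move=> a u v Pu Pv; rewrite pil; apply: PD.
exists (\dim U), (fun i => pi (vbasis U)`_i); split.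
  by move=> i; apply/UP/vbasis_mem/mem_nth; rewrite size_tuple.
move=> x Px; have xU : phi x \in U by apply/UP; rewrite phiK.
exists (fun i => coord (vbasis U) i (phi x)).
rewrite -{1}[x]phiK {1}(coord_vbasis xU).
by rewrite (kpi_sum _ (fun i : 'I_(\dim U) => (vbasis U)`_i) pil pi0).
Qed.

(** The functionals are the coordinates of what is left of [phi x] after projection to the subspace
    corresponding to [P]. *)
Lemma submodule_functionals M (P : M -> Prop) : submodule P ->
  exists n (l : 'I_n -> M -> k),
    (forall i, klinear (l i : M -> k^o)) /\ forall x, P x <-> forall i, l i x = 0.
Proof.
move=> [P0 PD]; have [n [phi [pi [phil pil phiK]]]] := coordinates M.
have pi0 : pi 0 = 0.
  by rewrite -(klinear0 phil) phiK.
have [||U UP] := @subspace_vspace _ _ (fun v => P (pi v)).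
- by rewrite pi0.
- by move=> a u v Pu Pv; rewrite pil; apply: PD.
pose l x := phi x - projv U (phi x).
exists n, (fun i x => l x 0 i); split.
  move=> i c x y.
  have -> : l (c *k x + y) = c *: l x + l y.
    by rewrite /l phil linearP scalerBr opprD addrACA.
  by rewrite !mxE.
move=> x; split=> [Px i|l0].
  have xU : phi x \in U by apply/UP; rewrite phiK.
  by rewrite /l projv_id // subrr mxE.
have : l x = 0 by apply/rowP => i; rewrite l0 mxE.
move/eqP; rewrite subr_eq0 => /eqP e.
by rewrite -[x]phiK; apply/UP; rewrite e memv_proj.
Qed.

(** The factor of [f] through [d] extends from the image of [d] to [N]; dual modules inherit their
    injectivity from this. *)
Lemma klinear_extend M N (d : {linear M -> N}) (f : M -> k) :
  klinear (f : M -> k^o) -> (forall x, d x = 0 -> f x = 0) ->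
  exists l : N -> k, klinear (l : N -> k^o) /\ forall x, l (d x) = f x.
Proof.
move=> fl df.
have [n [phi [pi [phil pil phiK]]]] := coordinates M.
have [m [psi [rho [psil rhol psiK]]]] := coordinates N.
pose Df v := psi (d (pi v)); pose ff v : k^o := f (pi v).
have Dl : linear Df by move=> c u v; rewrite /Df pil kact_lin psil.
have ffl : linear ff by move=> c u v; rewrite /ff pil fl.
pose D := linfun (mklin Dl); pose F := linfun (mklin ffl).
have H v : D v = 0 -> F v = 0.
  rewrite !lfunE /= => Dv0; apply: df.
  by rewrite -[d _]psiK -/(Df v) Dv0 -(klinear0 psil) psiK.
exists (fun y => F (D^-1%VF (psi y))); split.
  by move=> c x y; rewrite psil !linearP.
move=> x; have := lfun_factor H (phi x).
by rewrite !lfunE /= /Df /ff phiK.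
Qed.

(** The matrices that represent module maps form a subspace of a finite dimensional space; its basis
    gives the [g i]. *)
Lemma hom_span M N : exists n (g : 'I_n -> {linear M -> N}),
  forall f : {linear M -> N}, exists c : 'I_n -> k,
    forall x, f x = \sum_i c i *k g i x.
Proof.
have [m [phi [pi [phil pil phiK]]]] := coordinates M.
have [n [psi [rho [psil rhol psiK]]]] := coordinates N.
have psi0 := klinear0 psil.
pose P (h : 'Hom('rV[k]_m, 'rV[k]_n)) :=
  exists g : {linear M -> N}, forall x, h (phi x) = psi (g x).
have rho0 : rho 0 = 0 by rewrite -psi0 psiK.
have [||U UP] := @subspace_vspace _ _ P.
- exists (mklin (f := fun=> 0) (fun a x y => esym (etrans (addr0 _) (scaler0 _ a)))).
  by move=> x; rewrite lfunE /= psi0.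
- move=> c u v [g gE] [g' gE'].
  have hl : linear (fun x => c *k g x + g' x).
    move=> a x y; rewrite !linearP scalerDr addrACA -kact_swap /kact.
    by rewrite scalerDr.
  exists (mklin hl) => x /=.
  by rewrite psil !lfunE /= lfunE /= gE gE'.
pose b (i : 'I_(\dim U)) : 'Hom('rV[k]_m, 'rV[k]_n) := (vbasis U)`_i.
have bP i : exists g : {linear M -> N}, forall x, b i (phi x) = psi (g x).
  by apply/UP/vbasis_mem/mem_nth; rewrite size_tuple.
pose g i := proj1_sig (constructive_indefinite_description _ (bP i)).
have gE i x : b i (phi x) = psi (g i x).
  by rewrite /g; case: constructive_indefinite_description.
exists (\dim U), g => f.
have hl : linear (fun v => psi (f (pi v))) by move=> c u v; rewrite pil kact_lin psil.
have hU : linfun (mklin hl) \in U.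
  by apply/UP; exists f => x; rewrite lfunE /= phiK.
exists (fun i => coord (vbasis U) i (linfun (mklin hl))) => x.
have e : linfun (mklin hl) (phi x) =
    (\sum_i coord (vbasis U) i (linfun (mklin hl)) *: (vbasis U)`_i) (phi x).
  by rewrite -(coord_vbasis hU).
rewrite lfunE sum_lfunE /= phiK in e; rewrite -[LHS]psiK e.
rewrite (eq_bigr (fun i => coord (vbasis U) i (linfun (mklin hl)) *: psi (g i x))).
  by rewrite (kpi_sum _ (fun i => psi (g i x)) rhol rho0); apply: eq_bigr => i _; rewrite psiK.
by move=> i _; rewrite scale_lfunE -gE.
Qed.

End Coordinates.

Section FinDimModules.
Variables (k : fieldType) (A : fdAlgebra k).
Implicit Types L M N U V D : fdmod A.

Local Notation "c *k x" := (kact c x) (at level 40).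

Fact ker_fin_dim M N (g : {linear M -> N}) : fin_dim (ker_type g : lmodType A^c).
Proof.
have sub : submodule (fun x : M => g x = 0).
  split=> [|a x y]; first exact: linear0.
  by rewrite linearP => -> ->; rewrite scaler0 addr0.
have [n [s [s0 sP]]] := submodule_span sub.
pose t i := proj1_sig (constructive_indefinite_description _ (ker_val_onto (s0 i))).
have tE i : ker_incl g (t i) = s i.
  by rewrite /t; case: constructive_indefinite_description.
exists n, t => x; have [c cE] := sP _ (ker_val0 x); exists c.
apply: val_inj; rewrite -[val x]/(ker_val x) cE -[RHS]/(ker_incl g _) linear_sum.
by apply: eq_bigr => i _; rewrite linearZ tE.
Qed.

Definition ker_mod M N (g : {linear M -> N}) : fdmod A := FdMod (ker_fin_dim g).

Fact reg_fin_dim : fin_dim (A^c^o : lmodType A^c).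
Proof.
have [n [s sP]] := fdalg_fin_dim A.
exists n, s => a; have [c ->] := sP a; exists c; apply: eq_bigr => i _.
exact: fdalg_central.
Qed.

Definition reg_mod : fdmod A := FdMod reg_fin_dim.

Fact pair_fin_dim M N : fin_dim ((M * N)%type : lmodType A^c).
Proof.
have [n [s sP]] := fdmod_fin_dim M; have [m [t tP]] := fdmod_fin_dim N.
pose u (i : 'I_(n + m)) : (M * N)%type :=
  match split i with inl j => (s j, 0) | inr j => (0, t j) end.
exists (n + m)%N, u => -[x y].
have [c ->] := sP x; have [c' ->] := tP y.
exists (fun i => match split i with inl j => c j | inr j => c' j end).
rewrite big_split_ord /=.
rewrite (eq_bigr (fun i => (c i *k s i, 0))); last first.
  move=> i _; rewrite /u (unsplitK (inl i)); congr pair.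
  by rewrite /= scaler0.
rewrite [X in _ = _ + X](eq_bigr (fun i => (0, c' i *k t i))); last first.
  move=> i _; rewrite /u (unsplitK (inr i)); congr pair.
  by rewrite /= scaler0.
rewrite -[LHS]/(_, _).
by apply: injective_projections;
  rewrite /= ?(big_morph (@fst M N) (id1 := 0) (op1 := +%R))
             ?(big_morph (@snd M N) (id1 := 0) (op1 := +%R)) //=
          ?[\sum_(_ < _) 0]big1 ?addr0 ?add0r.
Qed.

Definition pair_mod M N : fdmod A := FdMod (pair_fin_dim M N).

Fact ffun_fin_dim n M : fin_dim ({ffun 'I_n -> M} : lmodType A^c).
Proof.
have [m [s sP]] := fdmod_fin_dim M.
pose I := ('I_n * 'I_m)%type.
exists #|{: I}|, (fun i => let jl := enum_val i in
  [ffun j => if j == jl.1 then s jl.2 else 0]) => x.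
pose c j := proj1_sig (constructive_indefinite_description _ (sP (x j))).
have cE j : x j = \sum_l c j l *k s l by rewrite /c; case: constructive_indefinite_description.
exists (fun i => let jl := enum_val i in c jl.1 jl.2).
apply/ffunP => j; rewrite sum_ffunE.
rewrite -(big_enum_val (op := +%R) (fun jl : I =>
   (c jl.1 jl.2 *k [ffun j => if j == jl.1 then s jl.2 else 0] : {ffun 'I_n -> M}) j) (A := {: I})) /=.
rewrite (eq_bigl xpredT) => [|//].
rewrite -(pair_big xpredT xpredT
  (fun j' l => (c j' l *k [ffun j => if j == j' then s l else 0] : {ffun 'I_n -> M}) j)) /=.
rewrite (bigD1 j) //= [X in _ + X]big1 ?addr0.
  by rewrite cE; apply: eq_bigr => l _; rewrite !ffunE eqxx.
by move=> j' nj; rewrite big1 // => l _; rewrite !ffunE eq_sym (negPf nj) scaler0.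
Qed.

Definition ffun_mod n M : fdmod A := FdMod (ffun_fin_dim n M).

Definition mgen M U : Prop :=
  exists n (p : 'I_n -> {linear M -> U}) (q : 'I_n -> {linear U -> M}),
    forall x, \sum_i p i (q i x) = x.

Definition ffun_single n M (i : 'I_n) (m : M) : {ffun 'I_n -> M} :=
  [ffun j => if j == i then m else 0].

Fact ffun_single_linear n M (i : 'I_n) : linear (@ffun_single n M i).
Proof.
move=> a x y; apply/ffunP => j; rewrite !ffunE; case: eqP => // _.
by rewrite scaler0 addr0.
Qed.

Lemma sum_ffun_single n M (x : {ffun 'I_n -> M}) : \sum_i ffun_single i (x i) = x.
Proof.
apply/ffunP => j; rewrite sum_ffunE (bigD1 j) //= big1 ?addr0 ?ffunE ?eqxx //.
by move=> i nj; rewrite ffunE eq_sym (negPf nj).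
Qed.

Fact ffun_ev_linear n M (i : 'I_n) : linear (fun x : {ffun 'I_n -> M} => x i).
Proof. by move=> a x y; rewrite !ffunE. Qed.

Lemma mgenP M U : in_add_mod M U <-> mgen M U.
Proof.
split=> [[n [V [f [g fK gK]]]]|[n [p [q pq]]]].
  have gl : linear g := can2_linear fK gK.
  have pl i : linear (fun m => (g (ffun_single i m)).1).
    by move=> a x y; rewrite ffun_single_linear gl.
  have ql i : linear (fun u => f (u, 0) i).
    move=> a x y; have -> : (a *: x + y, 0) = a *: (x, 0) + (y, 0) :> (U * V)%type.
      by congr pair; rewrite /= scaler0 addr0.
    by rewrite linearP !ffunE.
  exists n, (fun i => mklin (pl i)), (fun i => mklin (ql i)) => x.
  pose h : {linear {ffun 'I_n -> M} -> U} := fst \o mklin gl.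
  transitivity (h (\sum_i ffun_single i (f (x, 0) i))).
    by rewrite linear_sum.
  by rewrite sum_ffun_single /h /= fK.
pose ps (w : {ffun 'I_n -> M}) := \sum_i p i (w i).
pose qs u : {ffun 'I_n -> M} := [ffun i => q i u].
have psl : linear ps.
  move=> a x y; rewrite /ps scaler_sumr -big_split; apply: eq_bigr => i _.
  by rewrite !ffunE linearP.
have qsl : linear qs.
  by move=> a x y; apply/ffunP => i; rewrite !ffunE linearP.
pose pm : {linear ffun_mod n M -> U} := mklin psl.
have pqs u : ps (qs u) = u.
  by rewrite -{2}[u]pq; apply: eq_bigr => i _; rewrite ffunE.
(* The complement of [U] in $M^n$ is the kernel of the split surjection [ps]. *)
pose V := ker_mod pm.
pose f (uv : (U * V)%type) : {ffun 'I_n -> M} := qs uv.1 + ker_val uv.2.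
have fl : linear f.
  by move=> a [u v] [u' v']; rewrite /f /= qsl scalerDr addrACA.
have k0 w : pm (w - qs (ps w)) = 0 by rewrite linearB /= pqs subrr.
exists n, V, (mklin fl).
exists (fun w => (ps w, KerElt (introT eqP (k0 w)) : V)) => [[u v]|w].
  have ker0 : ps (ker_val v) = 0 := ker_val0 v.
  have e : ps (f (u, v)) = u.
    by rewrite /f -[qs _]scale1r psl scale1r pqs ker0 addr0.
  congr pair; first exact: e.
  by apply: val_inj; rewrite /= e /f addrC addKr.
by rewrite /= /f /= addrC subrK.
Qed.

Lemma retract_mgen M U (p : {linear M -> U}) (q : {linear U -> M}) :
  (forall x, p (q x) = x) -> mgen M U.
Proof. by move=> pq; exists 1, (fun=> p), (fun=> q) => x; rewrite big_ord1. Qed.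

Lemma mgen_trans M U V : mgen M U -> mgen U V -> mgen M V.
Proof.
move=> [n [p [q e]]] [n' [p' [q' e']]].
pose I := ('I_n' * 'I_n)%type.
exists #|{: I}|, (fun i => let ij := enum_val i in p' ij.1 \o p ij.2 : {linear _ -> _}),
  (fun i => let ij := enum_val i in q ij.2 \o q' ij.1 : {linear _ -> _}) => x.
rewrite -(big_enum_val (op := +%R) (fun ij : I =>
   (p' ij.1 (p ij.2 (q ij.2 (q' ij.1 x))))) (A := {: I})) /=.
rewrite (eq_bigl xpredT) => [|//].
rewrite -(pair_big xpredT xpredT
  (fun i j => p' i (p j (q j (q' i x))))) /= -[RHS]e'.
by apply: eq_bigr => i _; rewrite -linear_sum e.
Qed.

Lemma mgen_pair M U V : mgen M U -> mgen M V -> mgen M (pair_mod U V).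
Proof.
move=> [n [p [q e]]] [n' [p' [q' e']]].
have i1l : linear (fun u : U => (u, 0) : pair_mod U V).
  by move=> a x y; congr pair; rewrite /= scaler0 addr0.
have i2l : linear (fun v : V => (0, v) : pair_mod U V).
  by move=> a x y; congr pair; rewrite /= scaler0 addr0.
pose p1 : {linear pair_mod U V -> U} := fst.
pose p2 : {linear pair_mod U V -> V} := snd.
exists (n + n')%N,
  (fun i => match split i with
     inl j => mklin i1l \o p j : {linear _ -> _}
   | inr j => mklin i2l \o p' j : {linear _ -> _} end),
  (fun i => match split i with
     inl j => q j \o p1 : {linear _ -> _} | inr j => q' j \o p2 : {linear _ -> _} end).
move=> [u v]; rewrite big_split_ord /=.
rewrite (eq_bigr (fun i => mklin i1l (p i (q i u)))); last first.
  by move=> i _; rewrite (unsplitK (inl i)).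
rewrite [X in _ + X = _](eq_bigr (fun i => mklin i2l (p' i (q' i v)))); last first.
  by move=> i _; rewrite (unsplitK (inr i)).
rewrite -!linear_sum e e' /=.
by congr pair; rewrite /= ?addr0 ?add0r.
Qed.

End FinDimModules.

(** * Projective resolutions and Ext *)

Section Resolutions.
Variables (k : fieldType) (A : fdAlgebra k).
Implicit Types B D K L M N P U V : fdmod A.

Definition exact_at L M N (f : {linear L -> M}) (g : {linear M -> N}) : Prop :=
  forall y, g y = 0 <-> exists x, f x = y.

Lemma exact_comp L M N (f : {linear L -> M}) (g : {linear M -> N}) x :
  exact_at f g -> g (f x) = 0.
Proof. by move=> fg; apply/fg; exists x. Qed.

Fact zero_linear U V : linear (fun _ : U => 0 : V).
Proof. by move=> a x y; rewrite scaler0 addr0. Qed.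

Definition zero_map U V : {linear U -> V} := mklin (@zero_linear U V).

Definition free_mod n : fdmod A := ffun_mod n (reg_mod A).

Lemma free_map n M (m : 'I_n -> M) :
  exists h : {linear free_mod n -> M}, forall x, h x = \sum_i (x i : A^c) *: m i.
Proof.
have hl : linear (fun x : free_mod n => \sum_i (x i : A^c) *: m i).
  move=> a x y; rewrite scaler_sumr -big_split; apply: eq_bigr => i _.
  by rewrite !ffunE scalerA; apply: scalerDl.
by exists (mklin hl).
Qed.

Lemma cover_submodule M (P : M -> Prop) : submodule P ->
  exists n (h : {linear free_mod n -> M}), forall x, P x <-> exists y, h y = x.
Proof.
move=> subP; have [n [s [Ps sP]]] := submodule_span subP; have [P0 PD] := subP.
have [h hE] := free_map s; exists n, h => x; split=> [/sP [c ->]|[y <-]].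
  exists [ffun i => fdalg_scalar A (c i) : A^c]; rewrite hE.
  by apply: eq_bigr => i _; rewrite ffunE.
rewrite hE; elim/big_rec: _ => // i z _ Pz; exact: PD.
Qed.

Lemma ker_submodule M N (g : {linear M -> N}) : submodule (fun x : M => g x = 0).
Proof.
split=> [|a x y]; first exact: linear0.
by rewrite linearP => -> ->; rewrite scaler0 addr0.
Qed.

Lemma free_projective n : projective (free_mod n).
Proof.
move=> M N g f gsurj.
pose e i : free_mod n := @ffun_single _ _ n (reg_mod A) i (1 : A^c).
pose m i := proj1_sig (constructive_indefinite_description _ (gsurj (f (e i)))).
have mE i : g (m i) = f (e i) by rewrite /m; case: constructive_indefinite_description.
have [h hE] := free_map m; exists h => x.
rewrite hE linear_sum /= -{2}[x]sum_ffun_single linear_sum.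
apply: eq_bigr => i _; rewrite linearZ mE -linearZ; congr (f _).
apply/ffunP => j; rewrite !ffunE; case: eqP => _; last exact: scaler0.
exact: (mulr1 (x i : A^c)).
Qed.

Lemma projective_dual_basis P : projective P ->
  exists n (p : 'I_n -> P) (q : 'I_n -> {linear P -> reg_mod A}),
    forall x, x = \sum_i (q i x : A^c) *: p i.
Proof.
move=> projP.
have [n [s sP]] := fdmod_fin_dim P; have [h hE] := free_map s.
have hsurj y : exists x, h x = y.
  have [c ->] := sP y; exists [ffun i => fdalg_scalar A (c i) : A^c].
  by rewrite hE; apply: eq_bigr => i _; rewrite ffunE.
have [r rE] := projP _ _ h (idfun : {linear P -> P}) hsurj.
have ql i : linear (fun x => (r x : free_mod n) i).
  by move=> a x y; rewrite linearP !ffunE.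
exists n, s, (fun i => mklin (ql i)) => x.
by rewrite -[LHS]rE hE.
Qed.

(** Only the finitely many [f (p i)] of a dual basis have to be lifted, so it suffices that the
    image of [g] contains that of [f]. *)
Lemma projective_lift P M N (g : {linear M -> N}) (f : {linear P -> N}) :
  projective P -> (forall x, exists y, g y = f x) ->
  exists h : {linear P -> M}, forall x, g (h x) = f x.
Proof.
move=> /projective_dual_basis [n [p [q pq]]] fg.
pose m i := proj1_sig (constructive_indefinite_description _ (fg (p i))).
have mE i : g (m i) = f (p i) by rewrite /m; case: constructive_indefinite_description.
have hl : linear (fun x => \sum_i (q i x : A^c) *: m i).
  move=> a x y; rewrite scaler_sumr -big_split; apply: eq_bigr => i _.
  by rewrite linearP scalerA; apply: scalerDl.
exists (mklin hl) => x; rewrite /= linear_sum {2}[x]pq linear_sum.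
by apply: eq_bigr => i _; rewrite !linearZ mE.
Qed.

(** Bundling source and target makes the construction of a free resolution a plain iteration. *)
Record fdhom := FdHom {
  fdhom_src : fdmod A; fdhom_tgt : fdmod A;
  fdhom_map :> {linear fdhom_src -> fdhom_tgt} }.

Lemma resolution_step_exists (f : fdhom) :
  exists g : {n : nat & {linear free_mod n -> fdhom_src f}},
    exact_at (projT2 g) (fdhom_map f).
Proof.
have [n [h hP]] := cover_submodule (ker_submodule (fdhom_map f)).
by exists (existT _ n h).
Qed.

Definition resolution_step (f : fdhom) : fdhom :=
  FdHom (projT2 (proj1_sig
    (constructive_indefinite_description _ (resolution_step_exists f)))).

Lemma resolution_exists M : inhabited (proj_resolution M).
Proof.
have [n [e eP]] := cover_submodule (P := fun _ : M => True) (conj I (fun _ _ _ _ _ => I)).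
pose st i := iter i resolution_step (FdHom e).
have ex i : exact_at (fdhom_map (st i.+1)) (fdhom_map (st i)).
  exact: (proj2_sig (constructive_indefinite_description _ (resolution_step_exists _))).
have pr i : projective (fdhom_src (st i)) by case: i => *; apply: free_projective.
constructor.
exists (fun i => fdhom_src (st i)) (fun i => fdhom_map (st i.+1)) e => //.
- by move=> m; apply/eP.
- exact: (ex 0%N).
- by move=> i; exact: (ex i.+1).
Qed.

Section FixedResolution.
Variables (N : fdmod A) (P : proj_resolution N).

Lemma pr_diff_diff i x : pr_diff P i (pr_diff P i.+1 x) = 0.
Proof. by apply/pr_exact; exists x. Qed.

Lemma pr_aug_diff x : pr_aug P (pr_diff P 0 x) = 0.
Proof. by apply/pr_exact0; exists x. Qed.

(* [left_res Q m e] for [e : A0 -> B] says that [e] continues to the left as an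
   exact sequence 0 -> A_m -> ... -> A_1 -> A0 -> B with A_1, ..., A_m in [Q];
   exactness at B is not required. *)
Fixpoint left_res (Q : fdmod A -> Prop) (m : nat) (A0 : fdmod A) B
    (e : {linear A0 -> B}) : Prop :=
  if m is m'.+1 then
    exists (A1 : fdmod A) (d : {linear A1 -> A0}), [/\ Q A1, exact_at d e & left_res Q m' d]
  else forall x, e x = 0 -> x = 0.

(* If the first lift h of f is not a cocycle, h d lands in the image of A_1 -> A0;
   the induction hypothesis in degree j.+1 lifts it to a cocycle with values in
   A_1, which is a coboundary s d, and one corrects h by s. *)
Lemma cocycle_lift (Q : fdmod A -> Prop) m j (A0 : fdmod A) B (e : {linear A0 -> B})
    (f : {linear pr_obj P j -> B}) :
  left_res Q m e ->
  (forall D i, Q D -> (j < i <= j + m)%N -> Ext_eq0 i N D) ->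
  (forall x, f (pr_diff P j x) = 0) -> (forall x, exists a, e a = f x) ->
  exists h : {linear pr_obj P j -> A0},
    (forall x, e (h x) = f x) /\ (forall x, h (pr_diff P j x) = 0).
Proof.
elim: m j A0 B e f => [|m IH] j A0 B e f res ext fd fe.
  have [h hE] := projective_lift (@pr_projective _ _ _ P j) fe.
  by exists h; split=> // x; apply: res; rewrite hE fd.
case: res => A1 [d [QA1 de res]].
have [h hE] := projective_lift (@pr_projective _ _ _ P j) fe.
pose hd : {linear pr_obj P j.+1 -> A0} := h \o pr_diff P j.
have [|||g [gE gd]] := IH j.+1 A1 A0 d hd res.
- move=> D i QD /andP [ji ijm]; apply: ext => //.
  by rewrite (ltnW ji) addnS -addSn.
- by move=> x; rewrite /hd /= pr_diff_diff linear0.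
- by move=> x; apply/de; rewrite /hd /= hE fd.
have [|s sE] := ext A1 j.+1 QA1 _ P g gd.
  by rewrite leqnn addnS ltnS leq_addr.
pose c : {linear pr_obj P j -> A0} := h \- (d \o s).
exists c; split=> x; rewrite /c /=.
  by rewrite linearB /= hE (exact_comp _ de) subr0.
by rewrite -sE gE /hd /= subrr.
Qed.

Definition injective_mod (I0 : fdmod A) : Prop :=
  forall M M' (d : {linear M -> M'}) (w : {linear M -> I0}),
    (forall x, d x = 0 -> w x = 0) ->
    exists w' : {linear M' -> I0}, forall x, w' (d x) = w x.

(* For [i : B -> I0] this asks for a coresolution B -> I0 -> I1 -> ... by
   injectives, whose last map has the lifting property of Hom(U, -). *)
Fixpoint inj_cores (U : fdmod A) (n : nat) B (I0 : fdmod A) (i : {linear B -> I0}) : Prop :=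
  if n is n'.+1 then
    injective_mod I0 /\
    exists (I1 : fdmod A) (d : {linear I0 -> I1}), exact_at i d /\ inj_cores U n' d
  else forall w : {linear U -> I0}, (forall u, exists b, i b = w u) ->
       exists h : {linear U -> B}, forall u, i (h u) = w u.

(** Once a zero module is reached, a coresolution can be padded with zeros to any length. *)
Lemma inj_cores0 U n B (I0 : fdmod A) (i : {linear B -> I0}) :
  (forall x : I0, x = 0) -> inj_cores U n i.
Proof.
move=> I00; elim: n B i => [|n IH] B i.
  by move=> w _; exists (zero_map _ _) => u; rewrite [RHS]I00 [LHS]I00.
split; first by move=> M M' e w _; exists (zero_map _ _) => x; rewrite [RHS]I00.
exists I0, (zero_map _ _); split; last exact: IH.
by move=> y; split=> // _; exists 0; rewrite [RHS]I00 linear0.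
Qed.

Lemma cocycle_coboundary0 B (I0 : fdmod A) (i : {linear B -> I0}) (f : {linear pr_obj P 0 -> B}) :
  inj_cores N 0 i -> (forall x, i (f (pr_diff P 0 x)) = 0) ->
  exists h : {linear N -> B}, forall x, i (f x) = i (h (pr_aug P x)).
Proof.
move=> lift fd.
have [||w wE] := @linear_factor_surj _ (pr_obj P 0) N I0 (pr_aug P) (i \o f).
- exact: pr_surj.
- by move=> x /pr_exact0 [y <-] /=.
have [|h hE] := lift w; last by exists h => x; rewrite hE wE.
by move=> u; have [x <-] := pr_surj P u; exists (f x); rewrite wE.
Qed.

(** Dimension shifting: injectivity of [I0] extends [i \o f] along the differential to [g0], and
    [d \o g0] is a cocycle one degree lower, where it is a coboundary. Correcting [g0] accordingly
    puts its values in the image of [i], through which it lifts. *)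
Lemma cocycle_coboundary n B (I0 : fdmod A) (i : {linear B -> I0}) (f : {linear pr_obj P n.+1 -> B}) :
  inj_cores N n.+1 i -> (forall x, i (f (pr_diff P n.+1 x)) = 0) ->
  exists g : {linear pr_obj P n -> B}, forall x, i (f x) = i (g (pr_diff P n x)).
Proof.
elim: n B I0 i f => [|n IH] B I0 i f [injI [I1 [d [id res]]]] fd;
  (have [|g0 g0E] := injI _ _ (pr_diff P _) (i \o f);
    first by move=> x /pr_exact [y <-] /=).
- have [|h hE] := cocycle_coboundary0 (f := g0) res.
    by move=> x; rewrite g0E (exact_comp _ id).
  pose c : {linear pr_obj P 0 -> I0} := g0 \- (h \o pr_aug P).
  have [|g gE] := projective_lift (g := i) (f := c) (@pr_projective _ _ _ P 0).
    by move=> x; apply/id; rewrite /c /= linearB /= hE subrr.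
  by exists g => x; rewrite gE /c /= g0E pr_aug_diff linear0 subr0.
have [|h hE] := IH _ _ d g0 res.
  by move=> x; rewrite g0E (exact_comp _ id).
pose c : {linear pr_obj P n.+1 -> I0} := g0 \- (h \o pr_diff P n).
have [|g gE] := projective_lift (g := i) (f := c) (@pr_projective _ _ _ P n.+1).
  by move=> x; apply/id; rewrite /c /= linearB /= hE subrr.
by exists g => x; rewrite gE /c /= g0E pr_diff_diff linear0 subr0.
Qed.

End FixedResolution.

(** Projective dimension by successive syzygies, a form suited to induction. *)
Fixpoint syz_dim_le (m : nat) M : Prop :=
  if m is m'.+1 then
    exists (P K : fdmod A) (i : {linear K -> P}) (p : {linear P -> M}),
      [/\ projective P, forall x, i x = 0 -> x = 0, exact_at i p,
          forall y, exists x, p x = y & syz_dim_le m' K]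
  else projective M.

Lemma syz_dim_proj_dim m M : syz_dim_le m M -> proj_dim_le m M.
Proof.
have free0 (x : free_mod 0) : x = 0 by apply/ffunP => -[].
elim: m M => [|m IH] M /=.
  move=> projM.
  (* The resolution is [M] in degree 0, followed by the zero module [free_mod 0]. *)
  pose o i := if i is _.+1 then free_mod 0 else M.
  have op i : projective (o i) by case: i => [|i] //; apply: free_projective.
  unshelve refine (ex_intro _ (@ProjResolution _ _ _ o
    (fun i => zero_map (o i.+1) (o i)) (idfun : {linear M -> M}) op _ _ _) _).
  - by move=> x; exists x.
  - by move=> x; split=> [/= ->|[y <-]] //; exists 0.
  - by move=> i x; split=> // _; exists 0; rewrite [x]free0.
  - by case=> // i _ x; apply: free0.
move=> [P [K [i [p [projP iinj ip psurj /IH [R Rm]]]]]].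
pose o i := if i is j.+1 then pr_obj R j else P.
have op j : projective (o j) by case: j => [|j] //; apply: pr_projective.
pose df j : {linear o j.+1 -> o j} :=
  match j return {linear o j.+1 -> o j} with
  | 0 => (i \o pr_aug R : {linear pr_obj R 0 -> P})
  | l.+1 => pr_diff R l
  end.
unshelve refine (ex_intro _ (@ProjResolution _ _ _ o df p op _ _ _) _).
- exact: psurj.
- move=> x; split=> [/ip [y <-]|[y <-]]; last exact: (exact_comp _ ip).
  by have [z <-] := pr_surj R y; exists z.
- case=> [|j] x; last exact: pr_exact.
  rewrite /df /=; split=> [/iinj /pr_exact0 //|/pr_exact0 ->].
  exact: linear0.
- by case=> // j; rewrite ltnS; apply: Rm.
Qed.

Lemma retract_projective P M (p : {linear P -> M}) (i : {linear M -> P}) :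
  (forall x, p (i x) = x) -> projective P -> projective M.
Proof.
move=> pi projP U V g f gs; have [h hE] := projP _ _ g (f \o p) gs.
by exists (h \o i : {linear M -> U}) => x; rewrite /= hE /= pi.
Qed.

(* A splitting of the top differential P_(n+1) -> P_n shortens the resolution:
   its cokernel is projective. *)
Lemma split_top_syz_dim n M (P : proj_resolution M)
    (g : {linear pr_obj P n -> pr_obj P n.+1}) :
  (forall x, g (pr_diff P n x) = x) -> syz_dim_le n M.
Proof.
elim: n M P g => [|n IH] M P g gd /=.
  (* This map vanishes on the image of the differential, so it descends to a section of the
     augmentation. *)
  pose c : {linear pr_obj P 0 -> pr_obj P 0} := idfun \- (pr_diff P 0 \o g).
  have [||s sE] := @linear_factor_surj _ _ _ _ (pr_aug P) c.
  - exact: pr_surj.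
  - by move=> x /pr_exact0 [y <-]; rewrite /c /= gd subrr.
  apply: (retract_projective (p := pr_aug P) (i := s)); last exact: pr_projective.
  move=> x; have [y <-] := pr_surj P x.
  by rewrite sE /c /= linearB /= pr_aug_diff subr0.
pose K := ker_mod (pr_aug P).
have [||a aE] := @linear_factor_inj _ (pr_obj P 0) K _ (ker_incl (pr_aug P)) (pr_diff P 0).
- by move=> y y0; apply: val_inj.
- by move=> x; apply/ker_val_onto/pr_aug_diff.
(* The shifted resolution, now resolving the first syzygy [K]. *)
unshelve eset (R := @ProjResolution _ _ K (fun i => pr_obj P i.+1)
  (fun i => pr_diff P i.+1) a (fun i => @pr_projective _ _ _ P i.+1) _ _ _).
- move=> y; have /pr_exact0 [x xE] := ker_val0 y.
  by exists x; apply: val_inj; apply: etrans (aE x) xE.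
- move=> x; rewrite -pr_exact; split=> [ax0|dx0].
    by rewrite -aE ax0.
  by apply: val_inj; have := aE x; rewrite dx0.
- by move=> i x; apply: pr_exact.
exists (pr_obj P 0), K, (ker_incl (pr_aug P)), (pr_aug P); split.
- exact: pr_projective.
- by move=> y y0; apply: val_inj.
- move=> x; split=> [/ker_val_onto //|[y <-]]; exact: ker_val0.
- exact: pr_surj.
- exact: (IH K R g gd).
Qed.

(** A finite spanning family of the maps from [M] to [N] assembles into one map from a power of [M]
    to [N], through which every map from the add of [M] factors. A spanning family of the maps from
    [N] to [M] serves for the other side. *)
Lemma mgen_functorially_finite M : functorially_finite (@mgen k A M).
Proof.
split=> N.
  have [r [g gP]] := hom_span M N.
  have fl : linear (fun x : ffun_mod r M => \sum_i g i (x i)).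
    move=> a x y; rewrite scaler_sumr -big_split; apply: eq_bigr => i _.
    by rewrite !ffunE linearP.
  exists (ffun_mod r M), (mklin fl); split.
    exists r, (fun i => mklin (@ffun_single_linear _ _ r M i)),
      (fun i => mklin (@ffun_ev_linear _ _ r M i)).
    exact: sum_ffun_single.
  move=> V h [n [p [q pq]]].
  pose c i := proj1_sig (constructive_indefinite_description _ (gP (h \o p i))).
  have cE i x : h (p i x) = \sum_j kact (c i j) (g j x).
    by rewrite /c; case: constructive_indefinite_description => ? /= <-.
  have sl : linear (fun v : V => [ffun j => \sum_i kact (c i j) (q i v)] : ffun_mod r M).
    move=> a x y; apply/ffunP => j; rewrite !ffunE scaler_sumr -big_split.
    apply: eq_bigr => i _; rewrite -kact_swap /kact.
    by rewrite linearP scalerDr.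
  exists (mklin sl) => v /=.
  rewrite -{1}[v]pq linear_sum (eq_bigr _ (fun i _ => cE i _)) exchange_big /=.
  apply: eq_bigr => j _; rewrite ffunE linear_sum; apply: eq_bigr => i _.
  by rewrite linearZ.
have [r [g gP]] := hom_span N M.
have fl : linear (fun x : N => [ffun i => g i x] : ffun_mod r M).
  by move=> a x y; apply/ffunP => i; rewrite !ffunE linearP.
exists (ffun_mod r M), (mklin fl); split.
  exists r, (fun i => mklin (@ffun_single_linear _ _ r M i)),
    (fun i => mklin (@ffun_ev_linear _ _ r M i)).
  exact: sum_ffun_single.
move=> V h [n [p [q pq]]].
pose c i := proj1_sig (constructive_indefinite_description _ (gP (q i \o h))).
have cE i x : q i (h x) = \sum_j kact (c i j) (g j x).
  by rewrite /c; case: constructive_indefinite_description => ? /= <-.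
have sl : linear (fun w : ffun_mod r M => \sum_i p i (\sum_j kact (c i j) (w j))).
  move=> a x y; rewrite scaler_sumr -big_split; apply: eq_bigr => i _ /=.
  rewrite -linearP; congr (p i _); rewrite scaler_sumr -big_split /=.
  by apply: eq_bigr => j _; rewrite !ffunE -kact_swap /kact scalerDr.
exists (mklin sl) => x /=; rewrite -{1}[h x]pq; apply: eq_bigr => i _.
by rewrite cE; congr (p i _); apply: eq_bigr => j _; rewrite ffunE.
Qed.

End Resolutions.

(** * The functor T(T, -) and Serre duality *)

Section HomFunctor.
Variables (k : fieldType) (C : linCat k) (T : C).
Implicit Types X Y Z : C.

Definition homT X : Type := hom T X.

HB.instance Definition _ X := GRing.Zmodule.copy (homT X) (hom T X).

Definition homT_scale X (a : (endoAlg T)^c) (x : homT X) : homT X :=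
  comp (x : hom T X) (a : hom T T).

Fact homT_scaleA X a b (x : homT X) :
  homT_scale a (homT_scale b x) = homT_scale (a * b) x.
Proof. exact: esym (compA _ _ _). Qed.
Fact homT_scale1 X : left_id 1 (@homT_scale X).
Proof. by move=> x; apply: compm1. Qed.
Fact homT_scaleDr X : right_distributive (@homT_scale X) +%R.
Proof. by move=> a x y; apply: compDl. Qed.
Fact homT_scaleDl X (x : homT X) : {morph (@homT_scale X)^~ x : a b / a + b}.
Proof. by move=> a b; apply: compDr. Qed.

HB.instance Definition _ X := GRing.Zmodule_isLmodule.Build (endoAlg T)^c (homT X)
  (@homT_scaleA X) (@homT_scale1 X) (@homT_scaleDr X) (@homT_scaleDl X).

Lemma homT_scaleE X (a : (endoAlg T)^c) (x : homT X) :
  a *: x = (x : hom T X) \oc (a : hom T T) :> hom T X.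
Proof. by []. Qed.

Lemma homT_kact X c (x : homT X) : kact c x = c *: (x : hom T X) :> hom T X.
Proof. by rewrite /kact homT_scaleE /= /endo_scalar compZr compm1. Qed.

Fact homT_fin_dim X : fin_dim (homT X : lmodType (endoAlg T)^c).
Proof.
pose b := vbasis {:hom T X}.
exists (\dim {:hom T X}), (fun i => b`_i : hom T X) => x.
exists (fun i => coord b i (x : hom T X)).
rewrite {1}(coord_vbasis (memvf (x : hom T X))).
by apply: eq_bigr => i _; apply: esym (homT_kact _ _).
Qed.

Definition homTmod X : fdmod (endoAlg T) := FdMod (homT_fin_dim X).

Fact homTmap_linear X Y (f : hom X Y) :
  linear (fun x : homTmod X => (f \oc (x : hom T X)) : homTmod Y).
Proof. by move=> a x y; rewrite /= compDr; congr (_ + _); apply: compA. Qed.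

Definition homTmap X Y (f : hom X Y) : {linear homTmod X -> homTmod Y} :=
  mklin (homTmap_linear f).

Lemma homTmapE X Y (f : hom X Y) (x : hom T X) : homTmap f x = f \oc x.
Proof. by []. Qed.

Lemma homTmap_exact X Y Z (f : hom X Y) (g : hom Y Z) :
  cexact f g -> exact_at (homTmap f) (homTmap g).
Proof.
move=> [gf ex _] y; split=> [/ex [x ->]|[x <-]]; first by exists x.
by rewrite homTmapE /= compA gf comp0l.
Qed.

Lemma gen_mgen X Y : gen X Y -> mgen (homTmod X) (homTmod Y).
Proof.
move=> [n [p [q e]]].
exists n, (fun i => homTmap (p i)), (fun i => homTmap (q i)) => x.
rewrite -[RHS](comp1m (x : hom T Y)) -e comp_suml.
by apply: eq_bigr => i _; apply: compA.
Qed.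

Lemma homTmod0 X Y : gen X Y -> (forall f : hom T X, f = 0) ->
  forall f : hom T Y, f = 0.
Proof.
move=> [n [p [q e]]] X0 f; rewrite -[f]comp1m -e comp_suml big1 // => i _.
by rewrite -compA [q i \oc f]X0 comp0r.
Qed.

End HomFunctor.

Section FreeHom.
Variables (k : fieldType) (C : addCat k) (T : C).

(** The image of $T^n$ is free on the inclusions of the summands, so a family in [N] defines [h].
    Its image contains the [k]-span of the family and lies in the span over the endomorphism
    algebra. *)
Lemma homT_copies_map (N : fdmod (endoAlg T)) n (m : 'I_n -> N) :
  exists h : {linear homTmod T (dsum_copies n T) -> N},
    (forall c : 'I_n -> k, exists y, h y = \sum_i kact (c i) (m i)) /\
    forall y, exists a : 'I_n -> (endoAlg T)^c, h y = \sum_i a i *: m i.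
Proof.
have [p [q [e dl]]] := dsum_copies_biprod T n.
have hl : linear (fun x : homTmod T (dsum_copies n T) =>
    \sum_i (q i \oc (x : hom T _) : (endoAlg T)^c) *: m i).
  move=> a x y; rewrite scaler_sumr -big_split; apply: eq_bigr => i _ /=.
  rewrite scalerA -scalerDl; congr (_ *: _).
  by rewrite compDr; congr (_ + _); apply: compA.
exists (mklin hl); split=> [c|y]; last by exists (fun i => q i \oc (y : hom T _)).
exists (\sum_i c i *: (p i : hom T (dsum_copies n T))) => /=.
apply: eq_bigr => i _; rewrite /kact; congr (_ *: _).
rewrite comp_sumr (bigD1 i) //= big1 ?addr0 => [|j nj].
  by rewrite compZr dl eqxx.
by rewrite compZr dl eq_sym (negPf nj) scaler0.
Qed.

Lemma homT_copies_full m X (f : {linear homTmod T (dsum_copies m T) -> homTmod T X}) :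
  exists g : hom (dsum_copies m T) X, forall x, f x = homTmap T g x.
Proof.
have [p [q [e dl]]] := dsum_copies_biprod T m.
exists (\sum_i (f (p i) : hom T X) \oc q i) => x.
have xE : x = \sum_i (q i \oc (x : hom T _) : (endoAlg T)^c) *: (p i : homTmod T _).
  rewrite -[LHS](comp1m (x : hom T _)) -e comp_suml.
  by apply: eq_bigr => i _; rewrite homT_scaleE compA.
rewrite {1}xE linear_sum homTmapE comp_suml; apply: eq_bigr => i _.
by rewrite linearZ -compA.
Qed.

Lemma homT_presentation (N : fdmod (endoAlg T)) :
  exists a b (f : hom (dsum_copies a T) (dsum_copies b T))
    (e : {linear homTmod T (dsum_copies b T) -> N}),
    exact_at (homTmap T f) e /\ forall y, exists x, e x = y.
Proof.
have [b [s sP]] := fdmod_fin_dim N; have [e [eP _]] := homT_copies_map s.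
have [a [t [t0 tP]]] := submodule_span (ker_submodule e).
have [h [hP hE]] := homT_copies_map t; have [f fE] := homT_copies_full h.
exists a, b, f, e; split=> y; last by have [c ->] := sP y; apply: eP.
split=> [/tP [c ->]|[x <-]].
  by have [x <-] := hP c; exists x; rewrite fE.
rewrite -fE; have [c ->] := hE x; rewrite linear_sum big1 // => i _.
by rewrite linearZ t0; apply: scaler0.
Qed.

End FreeHom.

(** * Serre duality and the injective modules that it provides *)

Section Serre.
Variables (k : fieldType) (C : addCat k) (S : functor C C).
Implicit Types X Y Z : C.

Variable theta : forall X Y : C, {linear hom Y (S X) -> 'Hom(hom X Y, k^o)}.
Hypothesis theta_bij : forall X Y, bijective (theta X Y).
Hypothesis theta_natl : forall X X' Y (f : hom X X') (u : hom Y (S X)) (g : hom X' Y),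
  theta X' Y (fmap S f \oc u) g = theta X Y u (g \oc f).
Hypothesis theta_natr : forall X Y Y' (h : hom Y' Y) (u : hom Y (S X)) (g : hom X Y'),
  theta X Y' (u \oc h) g = theta X Y u (h \oc g).

Lemma theta_inj X Y (u v : hom Y (S X)) :
  (forall g, theta X Y u g = theta X Y v g) -> u = v.
Proof. by move=> e; apply: (bij_inj (theta_bij X Y)); apply/lfunP. Qed.

Lemma theta_surj X Y (l : 'Hom(hom X Y, k^o)) : exists u, theta X Y u = l.
Proof. by have [g _ gK] := theta_bij X Y; exists (g l). Qed.

Lemma theta_eval X Y (u : hom Y (S X)) (g : hom X Y) :
  theta X X (u \oc g) (idm X) = theta X Y u g.
Proof. by rewrite theta_natr compm1. Qed.

(** [S] is given as an ordinary functor; naturality and linearity of [theta] force it to be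
    additive. *)
Lemma serreD X Y (f g : hom X Y) : fmap S (f + g) = fmap S f + fmap S g.
Proof.
apply: theta_inj => h; rewrite -[fmap S (f + g)]compm1 -[fmap S f]compm1.
by rewrite -[fmap S g]compm1 linearD add_lfunE !theta_natl compDr linearD.
Qed.

Lemma serre0 X Y : fmap S (0 : hom X Y) = 0.
Proof.
by have := serreD (0 : hom X Y) 0; rewrite addr0 -{1}[fmap _ _]addr0 => /addrI.
Qed.

Lemma gen_serre X Y : gen X Y -> gen (S X) (S Y).
Proof.
move=> [n [p [q e]]]; exists n, (fun i => fmap S (p i)), (fun i => fmap S (q i)).
rewrite -fmap_id -e (big_morph (@fmap _ _ _ S _ _) (@serreD _ _) (serre0 _ _)).
by apply: eq_bigr => i _; rewrite fmap_comp.
Qed.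

(** The functional [theta Y W u] vanishes on maps that factor through [g], which are exactly those
    killed by precomposition with [f]. It thus factors through that precomposition, and [v]
    represents the factor. *)
Lemma serre_exact X Y Z W (f : hom X Y) (g : hom Y Z) (u : hom W (S Y)) :
  cexact f g -> fmap S g \oc u = 0 -> exists v, u = fmap S f \oc v.
Proof.
move=> [_ _ ex] gu.
have fl : linear (fun h : hom Y W => h \oc f) := comp_linearl f.
pose D := linfun (mklin fl).
have H h : D h = 0 -> theta Y W u h = 0.
  rewrite lfunE /= => /ex [h' ->].
  by rewrite -theta_natl gu linear0 zero_lfunE.
have [v vE] := theta_surj ((theta Y W u \o D^-1)%VF : 'Hom(hom X W, k^o)).
exists v; apply: theta_inj => h; rewrite theta_natl vE comp_lfunE.
by rewrite -[LHS](lfun_factor H) lfunE.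
Qed.

Lemma serre_mono X Y W (f : hom X Y) (u : hom W (S X)) :
  (forall h : hom X W, exists h', h = h' \oc f) -> fmap S f \oc u = 0 -> u = 0.
Proof.
move=> fs fu; apply: theta_inj => h; have [h' ->] := fs h.
by rewrite -theta_natl fu !linear0 !zero_lfunE.
Qed.

Lemma serre_eq0 X Y : (forall f : hom X Y, f = 0) -> forall u : hom Y (S X), u = 0.
Proof. by move=> z u; apply: theta_inj => g; rewrite [g]z !linear0. Qed.

Lemma serre_eq0_inv X Y : (forall u : hom Y (S X), u = 0) -> forall f : hom X Y, f = 0.
Proof.
move=> z f; apply/eqP; apply/negPn/negP => f0.
have [p pf] : exists p : 'Hom(hom X Y, k^o), p f != 0.
  have l1 : linear (fun g : hom X Y => coord [tuple f] ord0 (projv <[f]> g) : k^o).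
    by move=> a x y; rewrite !linearP.
  exists (linfun (mklin l1)); rewrite lfunE /= projv_id ?memv_line //.
  by rewrite (coord_free ord0 ord0) ?seq1_free // eqxx oner_neq0.
by have [u uE] := theta_surj p; move: pf; rewrite -uE [u]z linear0 zero_lfunE eqxx.
Qed.

Variable T : C.

(* Evaluation at the identity of T identifies Hom(M, T(T, S T)) with the dual of M. *)
Lemma serre_hom_ext (M : lmodType (endoAlg T)^c) (w w' : {linear M -> homTmod T (S T)}) :
  (forall x, theta T T (w x) (idm T) = theta T T (w' x) (idm T)) ->
  forall x, w x = w' x.
Proof.
move=> H x; refine (@theta_inj T T (w x) (w' x) _) => g; rewrite -[LHS]theta_eval -[RHS]theta_eval.
have e (v : {linear M -> homTmod T (S T)}) :
    (v x : hom T (S T)) \oc g = v ((g : (endoAlg T)^c) *: x).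
  by rewrite linearZ.
by rewrite !e.
Qed.

Lemma serre_hom_exists (M : fdmod (endoAlg T)) (l : M -> k) :
  klinear (l : M -> k^o) ->
  exists w : {linear M -> homTmod T (S T)},
    forall x, theta T T (w x) (idm T) = l x.
Proof.
move=> ll.
have ml x : linear (fun g : hom T T => l ((g : (endoAlg T)^c) *: x) : k^o).
  move=> a g h; rewrite -ll; congr (l _).
  rewrite -(homT_kact a (g : homT T T)) /kact scalerDl; congr (_ + _).
  by rewrite scalerA.
pose w x := proj1_sig (constructive_indefinite_description _
  (theta_surj (linfun (mklin (ml x))))).
have wE x g : theta T T (w x) g = l ((g : (endoAlg T)^c) *: x).
  rewrite /w; case: constructive_indefinite_description => u uE.
  by rewrite [sval _]/= uE lfunE.
have wl : linear (w : M -> homTmod T (S T)).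
  move=> a x y; refine (@theta_inj T T (w (a *: x + y)) (a *: (w x : homT T (S T)) + w y) _) => g.
  rewrite linearD add_lfunE /= homT_scaleE theta_natr !wE scalerDr (klinearD _ _ ll).
  by rewrite scalerA.
by exists (mklin wl) => x; rewrite /= wE -[in RHS](scale1r x).
Qed.

(** Evaluation at the identity turns [w] into a functional on [M]; it extends along [d], and the
    extension corresponds to a module map again. *)
Lemma serre_injective : injective_mod (homTmod T (S T)).
Proof.
move=> M M' d w dw.
have ll (L : fdmod (endoAlg T)) (v : {linear L -> homTmod T (S T)}) :
    klinear (fun x => theta T T (v x) (idm T)).
  move=> c x y; rewrite kact_lin linearD add_lfunE.
  by rewrite homT_kact linearZ scale_lfunE.
have [|l [lk lE]] := klinear_extend (d := d) (ll M w).
  by move=> x /dw ->; rewrite linear0 zero_lfunE.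
have [w' w'E] := serre_hom_exists lk; exists w'.
apply: (@serre_hom_ext M (w' \o d) w) => x.
by rewrite /= w'E lE.
Qed.

(** [w] amounts to a functional on the morphisms from [T] to [X], and [theta] represents it by some
    [u]. *)
Lemma serre_full X (w : {linear homTmod T X -> homTmod T (S T)}) :
  exists u : hom X (S T), forall x, w x = homTmap T u x.
Proof.
have ll : linear (fun x : hom T X => theta T T (w x) (idm T)).
  by move=> c x y; rewrite -[c *: x]homT_kact (kact_lin w) linearD add_lfunE
    homT_kact linearZ scale_lfunE.
have [u uE] := theta_surj (linfun (mklin ll)); exists u.
apply: serre_hom_ext => x.
by rewrite homTmapE theta_eval uE lfunE.
Qed.

Lemma serre_faithful X (u : hom X (S T)) : (forall x : hom T X, u \oc x = 0) -> u = 0.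
Proof.
move=> ux; apply: theta_inj => g.
by rewrite -theta_eval ux !linear0 !zero_lfunE.
Qed.

Lemma gen_serre_injective V : gen T V -> injective_mod (homTmod T (S V)).
Proof.
move=> /gen_serre [n [p [q e]]] M M' d w dw.
have wi i : exists w' : {linear M' -> homTmod T (S T)},
    forall x, w' (d x) = homTmap T (q i) (w x).
  apply: (serre_injective (w := homTmap T (q i) \o w)) => x /dw /= ->.
  exact: comp0r.
pose w' i : {linear M' -> homTmod T (S V)} :=
  homTmap T (p i) \o proj1_sig (constructive_indefinite_description _ (wi i)).
have [v vE] := linear_sum_exists w'; exists v => x; rewrite vE.
rewrite -[RHS](comp1m (w x : hom T (S V))) -e comp_suml; apply: eq_bigr => i _.
rewrite /w' /=; case: constructive_indefinite_description => v' /= ->.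
exact: compA.
Qed.

Lemma gen_serre_full V X (w : {linear homTmod T X -> homTmod T (S V)}) :
  gen T V -> exists u : hom X (S V), forall x, w x = homTmap T u x.
Proof.
move=> /gen_serre [n [p [q e]]].
pose u i := proj1_sig (constructive_indefinite_description _
  (serre_full (homTmap T (q i) \o w))).
have uE i x : q i \oc (w x : hom T (S V)) = u i \oc (x : hom T X).
  by rewrite /u; case: constructive_indefinite_description => v /= <-.
exists (\sum_i p i \oc u i) => x.
rewrite -[LHS](comp1m (w x : hom T (S V))) -e homTmapE !comp_suml.
by apply: eq_bigr => i _; rewrite -!compA uE.
Qed.

Lemma gen_serre_faithful V X (u : hom X (S V)) : gen T V ->
  (forall x : hom T X, u \oc x = 0) -> u = 0.
Proof.
move=> /gen_serre [n [p [q e]]] ux.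
rewrite -[u]comp1m -e comp_suml big1 // => i _; rewrite -compA.
rewrite [q i \oc u](serre_faithful (u := q i \oc u)) ?comp0r // => x.
by rewrite -compA ux comp0r.
Qed.

(* P is cut out by functionals, and a functional on M is a map to T(T, S T). *)
Lemma serre_copies_map (M : fdmod (endoAlg T)) (P : M -> Prop) : submodule P ->
  exists n (w : {linear M -> homTmod T (S (dsum_copies n T))}),
    forall x, P x <-> w x = 0.
Proof.
move=> subP; have [n [l [lk lP]]] := submodule_functionals subP.
have [p [q [e dl]]] := dsum_copies_biprod T n.
pose v i := proj1_sig (constructive_indefinite_description _ (serre_hom_exists (lk i))).
have vE i x : theta T T (v i x) (idm T) = l i x.
  by rewrite /v; case: constructive_indefinite_description.
have [w wE] := linear_sum_exists (fun i => homTmap T (fmap S (p i)) \o v i : {linear _ -> _}).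
have qw i x : fmap S (q i) \oc (w x : hom T _) = v i x.
  rewrite wE /= comp_sumr (bigD1 i) //= big1 ?addr0 => [|j nj].
    by rewrite compA -fmap_comp dl eqxx fmap_id comp1m.
  by rewrite compA -fmap_comp dl eq_sym (negPf nj) serre0 comp0l.
exists n, w => x; split=> [Px|w0]; last first.
  apply/lP => i; rewrite -vE -qw w0 comp0r linear0.
  by rewrite lfunE.
rewrite wE big1 // => i _ /=.
suff -> : v i x = 0 by exact: comp0r.
have [P0 PD] := subP.
(* All multiples of [x] lie in the submodule [P], so [l i] kills them and [v i x] is zero. *)
refine (@theta_inj T T (v i x) 0 _) => g; rewrite -theta_eval linear0 zero_lfunE /=.
have -> : (v i x : hom T (S T)) \oc g = v i ((g : (endoAlg T)^c) *: x).
  by rewrite linearZ.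
rewrite vE; apply: (lP _).1; rewrite -[_ *: _]addr0; exact: PD.
Qed.

End Serre.

(** * The cluster tilting object *)

Section ClusterTilting.
Variables (k : fieldType) (d : nat) (C : angCat k d.+1).
Implicit Types X Y Z V W : C.
Local Notation Sg := (susp C).

Lemma gen_susp X Y : gen X Y -> gen (Sg X) (Sg Y).
Proof.
move=> [n [p [q e]]]; exists n, (fun i => fmap Sg (p i)), (fun i => fmap Sg (q i)).
rewrite -fmap_id -e (big_morph (@fmap _ _ _ Sg _ _) (@suspD _ _ _ _ _) (susp0 _ _)).
by apply: eq_bigr => i _; rewrite fmap_comp.
Qed.

Lemma gen_hom0 X Y Z : gen X Y -> (forall f : hom X Z, f = 0) ->
  forall f : hom Y Z, f = 0.
Proof.
move=> [n [p [q e]]] z f; rewrite -[f]compm1 -e comp_sumr big1 // => i _.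
by rewrite compA [f \oc p i]z comp0l.
Qed.

Lemma cexact_susp X Y Z (f : hom X Y) (g : hom Y Z) :
  cexact (fmap Sg f) (fmap Sg g) -> cexact f g.
Proof.
move=> [e1 e2 e3]; split.
- by apply: susp_faithful; rewrite fmap_comp e1 susp0.
- move=> W h gh; have [|h' hE] := e2 _ (fmap Sg h).
    by rewrite -fmap_comp gh susp0.
  have [h'' h'E] := susp_full h'; exists h''; apply: susp_faithful.
  by rewrite hE h'E fmap_comp.
move=> W h hf; have [|h' hE] := e3 _ (fmap Sg h).
  by rewrite -fmap_comp hf susp0.
have [h'' h'E] := susp_full h'; exists h''; apply: susp_faithful.
by rewrite hE h'E fmap_comp.
Qed.

Lemma sign_neq0 n : (-1) ^+ n != 0 :> k.
Proof. by rewrite signr_eq0. Qed.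

Section LastPair.
Variable R : composable_pred C.

Lemma all_pairs_last n W X Y Z V (a : hom W X) (c : chain n X Y) (g : hom Y Z)
    (h : hom Z V) :
  all_pairs R a (crcons (crcons c g) h) -> R g h.
Proof. by elim: n W X a c => [|n IH] W X a c /= [_]; [case|apply: IH]. Qed.

Lemma all_pairs_rcons n W X Y Z (a : hom W X) (c : chain n X Y) (g : hom Y Z) :
  all_pairs R a (crcons c g) -> all_pairs R a c.
Proof. by elim: n W X a c => [|n IH] W X a c /= [h1 h2] //; split=> //; apply: IH. Qed.

(** [add_resolves] reads a chain from the left; this isolates its right end $V \to X \to E$. *)
Lemma resolves_last T X n A E W (a : hom W A) (c : chain n.+1 A E) :
  gen T A -> add_resolves T X c -> all_pairs R a c ->
  exists V (l : hom V X) (c' : chain n A X) (g : hom X E),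
    [/\ gen T V, c = crcons c' g & R l g].
Proof.
elim: n A W a c => [|n IH] A W a [Z [b c]] genA /=.
  by move=> eX; subst X => -[_ Rbc]; exists A, b, b, c.
move=> [addZ res] [_ pairs].
have [V [l [c' [g [genV cE Rlg]]]]] := IH _ _ b c (in_add_gen addZ) res pairs.
by exists V, l, (@ccons _ _ n _ _ _ b c'), g; split=> //; rewrite cE.
Qed.

End LastPair.

Variable T : C.
Hypothesis tiltT : cluster_tilting T.

Lemma tilt_hom0 V W : gen T V -> gen T W -> forall f : hom V (Sg W), f = 0.
Proof.
have [z _] := tiltT => gV gW; apply: (gen_hom0 gV) => f.
exact: (homTmod0 (gen_susp gW) z).
Qed.

Lemma angle_resolves_last X V Z (a : hom V Z) (c : chain d.+1 Z (Sg V)) :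
  angle (@ccons _ C d.+1 _ _ _ a c) -> in_add T Z -> add_resolves T X c ->
  all_pairs (@cexact k C) a c /\
  exists W (l : hom W X) (g : hom X (Sg V)),
    [/\ gen T W, cexact l g & cexact g (fmap Sg a)].
Proof.
move=> /angle_all_pairs pairs addZ res; have pairs' := all_pairs_rcons pairs.
split=> //.
have [W [l [c' [g [gW cE lg]]]]] := resolves_last (in_add_gen addZ) res pairs'.
exists W, l, g; split=> //.
by rewrite cE in pairs; apply: cexactZr (sign_neq0 _) (all_pairs_last pairs).
Qed.

(* The resolution of Sg Y, extended one step to the left by Y. *)
Lemma tilt_resolution Y :
  exists V (g : hom Y V) (c : chain d.+2 V (Sg V)),
    [/\ gen T V, add_resolves T (Sg Y) c, all_pairs (@cexact k C) g c
      & forall h : hom Y T, exists h', h = h' \oc g].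
Proof.
have [_ /(_ (Sg Y)) [V [[Z [a c]] [ang addV [addZ res]]]]] := tiltT.
have [pairs [W [l [g [gW lg ga]]]]] := angle_resolves_last ang addZ res.
(* Fullness of [Sg] desuspends the connecting morphism [g], which gives the extra arrow out of
   [Y]. *)
have [g' g'E] := susp_full g; rewrite g'E in ga.
exists V, g', (existT _ Z (a, c)); split=> //.
- exact: in_add_gen.
- by split=> //; apply: cexact_susp.
(* [fmap Sg h \oc l] goes from [W] to [Sg T], hence is zero, so [fmap Sg h] factors through the weak
   cokernel [g] of [l]. *)
move=> h; have [_ _ ex] := lg.
have [|h' hE] := ex _ (fmap Sg h); first exact: (tilt_hom0 gW (gen_refl T)).
have [h'' h'E] := susp_full h'; exists h''; apply: susp_faithful.
by rewrite hE h'E g'E fmap_comp.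
Qed.

Variable S : functor C C.
Variable theta : forall X Y : C, {linear hom Y (S X) -> 'Hom(hom X Y, k^o)}.
Hypothesis theta_bij : forall X Y, bijective (theta X Y).
Hypothesis theta_natl : forall X X' Y (f : hom X X') (u : hom Y (S X)) (g : hom X' Y),
  theta X' Y (fmap S f \oc u) g = theta X Y u (g \oc f).
Hypothesis theta_natr : forall X Y Y' (h : hom Y' Y) (u : hom Y (S X)) (g : hom X Y'),
  theta X Y' (u \oc h) g = theta X Y u (h \oc g).

Local Notation F := (homTmod T).
Local Notation Fm := (homTmap T).

Lemma serre_homT_exact X Y Z (f : hom X Y) (g : hom Y Z) : cexact f g ->
  exact_at (Fm (fmap S f)) (Fm (fmap S g)).
Proof.
move=> fg y; split=> [gy|[x <-]].
  by have [v vE] := serre_exact theta_bij theta_natl fg gy; exists v.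
case: fg => gf _ _.
rewrite !homTmapE compA -fmap_comp gf; rewrite (serre0 theta_bij theta_natl).
exact: comp0l.
Qed.

(** For the final lifting property, a map from [F X] to [F (S V)] comes from some [u]. If its values
    lie in the image of [Fm (fmap S b)], the next arrow kills [u] by faithfulness, so [u] factors
    through [fmap S b]. The bound [n < m] keeps the target of that arrow in the range where
    faithfulness holds. *)
Lemma tilt_inj_cores X U n m V E W (b : hom W V) (c : chain m.+1 V E) X' :
  mgen (F X) U -> gen T V -> add_resolves T X' c -> all_pairs (@cexact k C) b c ->
  (n < m)%N -> inj_cores U n (Fm (fmap S b)).
Proof.
move=> mU; elim: n m V E W b c => [|n IH] [//|m] V E W b c gV [addZ res] [bc pairs] nm.
  move=> w wb; have [r [p [q pq]]] := mU.
  have H i : exists v : hom X (S W), forall x, w (p i x) = Fm (fmap S b) (Fm v x).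
    have [u uE] := gen_serre_full theta_bij theta_natl theta_natr
      (w \o p i : {linear _ -> _}) gV.
    have su : fmap S (cfst c) \oc u = 0.
      apply: (gen_serre_faithful theta_bij theta_natl theta_natr (in_add_gen addZ)) => x.
      have [y yE] := wb (p i x).
      rewrite -compA -[u \oc x]/(Fm u x) -uE /= -yE.
      exact: (exact_comp y (serre_homT_exact bc)).
    have [v vE] := serre_exact theta_bij theta_natl bc su.
    exists v => x; rewrite [LHS](uE x) vE.
    by rewrite !homTmapE compA.
  pose v i := proj1_sig (constructive_indefinite_description _ (H i)).
  have vE i x : w (p i x) = Fm (fmap S b) (Fm (v i) x).
    by rewrite /v; case: constructive_indefinite_description.
  have [h hE] := linear_sum_exists (fun i => Fm (v i) \o q i : {linear _ -> _}).
  exists h => u; rewrite hE linear_sum -[in RHS](pq u) linear_sum.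
  by apply: eq_bigr => i _; rewrite vE.
split; first exact: (gen_serre_injective theta_bij theta_natl theta_natr gV).
exists (F (S (chd c))), (Fm (fmap S (cfst c))); split.
  exact: serre_homT_exact.
exact: (IH m _ _ _ (cfst c) (ctl c) (in_add_gen addZ) res pairs).
Qed.

(** The final term [F (S X)] is zero, so the coresolution ends there and zeros continue it. *)
Lemma tilt_inj_cores_end U n m V E W (b : hom W V) (c : chain m.+1 V E) X :
  gen T V -> add_resolves T X c -> all_pairs (@cexact k C) b c ->
  (forall f : hom T (S X), f = 0) -> (m < n)%N ->
  inj_cores U n (Fm (fmap S b)).
Proof.
move=> gV res pairs SX0.
elim: m n V E W b c gV res pairs => [|m IH] [//|n] V E W b c gV res [bc pairs] nm;
  (split; first exact: (gen_serre_injective theta_bij theta_natl theta_natr gV));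
  exists (F (S (chd c))), (Fm (fmap S (cfst c)));
  (split; first exact: serre_homT_exact).
  by apply: inj_cores0; rewrite /= in res; rewrite res; apply: SX0.
case: res => addZ res.
exact: (IH n _ _ _ (cfst c) (ctl c) (in_add_gen addZ) res pairs).
Qed.

Hypothesis serre_surj : forall Y, exists Y', isomorphic (S Y') Y.

Lemma homT_Ext_eq0 X Y (U V : fdmod (endoAlg T)) i :
  mgen (F X) U -> mgen (F Y) V -> (1 <= i <= d)%N -> Ext_eq0 i U V.
Proof.
move=> mU mV; case: i => // j /= jd P f fd.
have [Y' isoY] := serre_surj Y.
have {mV} [r [p [q pq]]] :=
  mgen_trans (gen_mgen T (retract_gen (isomorphic_retract isoY))) mV.
have [W [b [c [gW res pairs surj]]]] := tilt_resolution Y'.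
have cores : inj_cores U j.+1 (Fm (fmap S b)).
  by apply: (tilt_inj_cores mU gW res pairs).
have mono y : Fm (fmap S b) y = 0 -> y = 0.
  exact: (serre_mono theta_bij theta_natl surj).
have H i : exists g : {linear pr_obj P j -> F (S Y')},
    forall x, q i (f x) = g (pr_diff P j x).
  have [|g gE] := cocycle_coboundary (f := q i \o f : {linear _ -> _}) cores.
    by move=> x; rewrite /= fd linear0 comp0r.
  exists g => x; apply/eqP; rewrite -subr_eq0; apply/eqP/mono.
  by rewrite linearB gE subrr.
pose g i := proj1_sig (constructive_indefinite_description _ (H i)).
have gE i x : q i (f x) = g i (pr_diff P j x).
  by rewrite /g; case: constructive_indefinite_description.
have [h hE] := linear_sum_exists (fun i => p i \o g i : {linear _ -> _}).
by exists h => x; rewrite hE -[LHS]pq; apply: eq_bigr => i _; rewrite gE.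
Qed.

(* The target of w is written as a suspension because the angle on f ends in Sg A. *)
Lemma serre_copresentation (N : fdmod (endoAlg T)) :
  exists A B (f : hom A B) (w : {linear N -> F (Sg A)}),
    [/\ forall x, w x = 0 -> x = 0, exact_at w (Fm (fmap Sg f))
      & forall x : hom T B, x = 0].
Proof.
suff desuspend : forall J0 J1 (u : hom J0 J1) (w : {linear N -> F J0}),
    (forall x, w x = 0 -> x = 0) -> exact_at w (Fm u) ->
    (forall x : hom (Sg T) J1, x = 0) ->
    exists A B (f : hom A B) (w : {linear N -> F (Sg A)}),
    [/\ forall x, w x = 0 -> x = 0, exact_at w (Fm (fmap Sg f))
      & forall x : hom T B, x = 0].
  have sub0 : submodule (fun x : N => x = 0).
    by split=> // a x y -> ->; rewrite scaler0 addr0.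
  have [n [w wP]] := serre_copies_map theta_bij theta_natl theta_natr sub0.
  have subw : submodule (fun y => exists x, w x = y).
    split=> [|a y y' [x <-] [x' <-]]; first by exists 0; rewrite linear0.
    by exists (a *: x + x'); rewrite linearP.
  have [m [w' w'P]] := serre_copies_map theta_bij theta_natl theta_natr subw.
  have [u uE] := gen_serre_full theta_bij theta_natl theta_natr w' (gen_copies T m).
  apply: (desuspend _ _ u w).
  - by move=> x /wP.
  - by move=> y; rewrite -uE; split=> /w'P.
  (* Morphisms from [Sg T] to [S] of $T^m$ are dual to morphisms from $T^m$ to [Sg T], which
     vanish. *)
  - apply: (serre_eq0 theta_bij); exact: (tilt_hom0 (gen_copies T m) (gen_refl T)).
move=> J0 J1 u w winj wu z.
have [A eA] := susp_surj J0; have [B eB] := susp_surj J1; subst J0 J1.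
have [f fE] := susp_full u; rewrite fE in wu.
exists A, B, f, w; split=> // x; apply: susp_faithful.
by rewrite susp0; apply: z.
Qed.

(** Passes along the chain from left to right; [j] counts the terms already collected to the left of
    the current arrow. *)
Lemma left_res_angle Q m Z E E' (c : chain m Z E) (g : hom E E') j :
  (forall X, Q (F X)) ->
  left_res Q j (Fm (cfst (crcons c g))) ->
  all_pairs (@cexact k C) (cfst (crcons c g)) (ctl (crcons c g)) ->
  exists Z' (l : hom Z' E), left_res Q (j + m) (Fm l) /\ cexact l g.
Proof.
move=> QF; elim: m Z c j => [|m IH] Z c j res pairs.
  by exists Z, c; rewrite addn0.
case: pairs => ex pairs; rewrite addnS -addSn; apply: IH pairs.
exists (F Z), (Fm (cfst c)); split=> //; exact: homTmap_exact ex.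
Qed.

Lemma Ext_left_orthogonal (N : fdmod (endoAlg T)) :
  (forall X i, (1 <= i <= d)%N -> Ext_eq0 i N (F X)) -> exists X, mgen (F X) N.
Proof.
move=> ext.
have [A [B [f [w [winj wf B0]]]]] := serre_copresentation N.
have [[Z [b c]] ang] := angle_exists f.
have /= [fb [bc pairs]] := angle_all_pairs ang.
pose Q D := forall i, (1 <= i <= d)%N -> Ext_eq0 i N D.
(* As [F B] is zero, the map out of [F Z] is injective, and the angle resolves the kernel of
   [Fm (fmap Sg f)], which is [N]. *)
have [|Z' [l [res lf]]] := left_res_angle (Q := Q) (j := 0) ext _ pairs.
  move=> x cx; have /(homTmap_exact (T := T) bc) [y <-] := cx.
  by rewrite [y]B0; apply: linear0.
have {}lf := homTmap_exact (T := T) (cexactZr (sign_neq0 _) lf).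
have [P] := resolution_exists N.
(* The lift of [w] to [F Z'] is a cocycle and descends to [s], which will be a section of [r]. *)
have [|||h [hE hd]] := cocycle_lift (P := P) (j := 0)
  (f := w \o pr_aug P : {linear pr_obj P 0 -> F (Sg A)}) res.
- by move=> D i QD; rewrite add0n add0n; apply: QD.
- by move=> x; rewrite /= pr_aug_diff linear0.
- by move=> x; apply/lf/wf; exists (pr_aug P x).
have [||s sE] := @linear_factor_surj _ (pr_obj P 0) N _ (pr_aug P) h.
- exact: pr_surj.
- by move=> x /pr_exact0 [y <-].
have [|r rE] := linear_factor_inj (f := Fm l) winj.
  by move=> x; apply/wf; apply/lf; exists x.
exists Z'; apply: (retract_mgen (p := r) (q := s)) => x.
apply/eqP; rewrite -subr_eq0; apply/eqP/winj.
rewrite linearB rE; have [y <-] := pr_surj P x.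
by rewrite sE hE /= subrr.
Qed.

(** * The modules that are right Ext-orthogonal to the add of [M] *)

Section RightOrthogonal.
Variables M N : fdmod (endoAlg T).
Hypothesis genM : forall X, mgen M (F X).
Hypothesis extN : forall D i, mgen M D -> (1 <= i <= d)%N -> Ext_eq0 i D N.
Hypothesis extM : forall D D' i, mgen M D -> mgen M D' -> (1 <= i <= d)%N ->
  Ext_eq0 i D D'.

(* [e : A -> B] is the last map of an exact sequence
   0 -> N -> A_m -> ... -> A_1 -> B with A_1 = A and the A_i in add M. *)
Fixpoint add_cores (m : nat) (A B : fdmod (endoAlg T)) (e : {linear A -> B}) : Prop :=
  if m is m'.+1 then
    mgen M A /\ exists (A' : fdmod (endoAlg T)) (a : {linear A' -> A}),
      exact_at a e /\ add_cores m' a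
  else A = N /\ forall x, e x = 0 -> x = 0.

Lemma add_cores_left_res (Q : fdmod (endoAlg T) -> Prop) m
    (A B : fdmod (endoAlg T)) (e : {linear A -> B}) :
  Q N -> (forall D, mgen M D -> Q D) -> add_cores m e -> left_res Q m e.
Proof.
move=> QN QM; elim: m A B e => [|m IH] A B e /= [].
  by [].
move=> mA [A' [a [ae res]]]; exists A', a; split=> //; last exact: IH.
by case: m res {IH} => [|m] /= [] => [eA' _|mA' _]; [rewrite eA'|apply: QM].
Qed.

(* The last map e splits, by s; then N -> ... -> A' + B -> A is a shorter
   coresolution, with last map (a, s). *)
Lemma add_cores_mgen m (A B : fdmod (endoAlg T)) (e : {linear A -> B}) :
  (m <= d)%N -> mgen M B -> (forall y, exists x, e x = y) -> add_cores m e ->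
  mgen M N.
Proof.
elim: m A B e => [|m IH] A B e md mB esurj.
  case=> eA; subst A => einj.
  have [r rE] := linear_factor_inj (f := (idfun : {linear B -> B})) einj esurj.
  apply: mgen_trans mB _; apply: (retract_mgen (p := r) (q := e)) => x.
  apply/eqP; rewrite -subr_eq0; apply/eqP/einj.
  by rewrite linearB rE /= subrr.
move=> cores; have [P] := resolution_exists B.
have res : left_res (fun D => forall i, (1 <= i <= d)%N -> Ext_eq0 i B D) m.+1 e.
  apply: add_cores_left_res cores.
    by move=> i; apply: extN.
  by move=> D mD i; apply: extM.
(* The augmentation stands for the identity of [B]; its lift along [e] kills boundaries and so
   yields the section [s]. *)
have [|||h [hE hd]] := cocycle_lift (P := P) (j := 0) (f := pr_aug P) res.
- move=> D i QD /andP [i0 im]; apply: QD; rewrite i0 /=.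
  exact: leq_trans im md.
- exact: pr_aug_diff.
- by move=> x; apply: esurj.
have [||s sE] := @linear_factor_surj _ (pr_obj P 0) B _ (pr_aug P) h.
- exact: pr_surj.
- by move=> x /pr_exact0 [y <-].
have es y : e (s y) = y by have [x <-] := pr_surj P y; rewrite sE hE.
case: cores => mA [A' [a [ae cores]]].
have el : linear (fun z : pair_mod A' B => a z.1 + s z.2).
  by move=> c z z' /=; rewrite !linearP scalerDr addrACA.
pose e' : {linear pair_mod A' B -> A} := mklin el.
have e'surj y : exists x, e' x = y.
  have /ae [x xE] : e (y - s (e y)) = 0 by rewrite linearB es subrr.
  by exists (x, e y); rewrite /= xE subrK.
(* The kernel of [e'] is that of [a], so the part of the sequence to the left of [A'] remains in
   place. *)
have e'0 x y : e' (x, y) = 0 -> y = 0 /\ a x = 0.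
  move=> e0; have y0 : y = 0.
    have : e (e' (x, y)) = y by rewrite /= linearD es (exact_comp _ ae) add0r.
    by rewrite e0 linear0.
  by split=> //; move: e0; rewrite y0 /= linear0 addr0.
case: m IH cores {res md} (ltnW md) => [|m] IH cores md.
  case: cores => eA' ainj; subst A'.
  have e'inj z : e' z = 0 -> z = 0.
    by case: z => x y /e'0 [-> /ainj ->].
  have [r rE] := linear_factor_inj (f := (idfun : {linear A -> A})) e'inj e'surj.
  apply: mgen_trans mA _.
  apply: (retract_mgen (p := fst \o r : {linear _ -> _}) (q := a)) => x /=.
  suff -> : r (a x) = (x, 0) by [].
  apply/eqP; rewrite -subr_eq0; apply/eqP/e'inj.
  by rewrite linearB rE /= linear0 addr0 subrr.
case: cores => mA' [A'' [a' [a'a cores]]].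
apply: (IH _ _ e' md mA e'surj); split; first exact: mgen_pair.
have bl : linear (fun x : A'' => (a' x, 0) : pair_mod A' B).
  by move=> c x y; rewrite linearP; congr pair; rewrite /= scaler0 addr0.
exists A'', (mklin bl); split.
  case=> x y; split=> [/e'0 [-> /a'a [z <-]]|[z [<- <-]]]; first by exists z.
  by rewrite /= linear0 addr0 (exact_comp _ a'a).
have b0 x : mklin bl x = 0 <-> a' x = 0.
  by split=> [[]|/= ->].
case: m {IH md} cores => [|m] /= [h1 h2]; split=> //.
  by move=> x /b0; apply: h2.
case: h2 => [A3 [a3 [h3 h4]]]; exists A3, a3; split=> // y.
exact: iff_trans (b0 y) (h3 y).
Qed.

(** Each arrow of the angle adds a term to [add_cores], and [j + m] is unchanged. At the end
    [F E = 0] provides the surjectivity that [add_cores_mgen] requires. *)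
Lemma add_cores_angle m Z E E' (c : chain m Z E) (g : hom E E') j
    (A : fdmod (endoAlg T)) (e : {linear A -> F Z}) :
  (j + m <= d)%N -> add_cores j e ->
  exact_at e (Fm (cfst (crcons c g))) ->
  all_pairs (@cexact k C) (cfst (crcons c g)) (ctl (crcons c g)) ->
  (forall x : hom T E, x = 0) -> mgen M N.
Proof.
move=> jm cores ex pairs E0; elim: m Z c j A e jm cores ex pairs => [|m IH] Z c j A e jm cores ex pairs.
  apply: (@add_cores_mgen j _ _ e) => //; first by rewrite -[j]addn0.
  by move=> y; apply/ex; apply: E0.
case: pairs => cc pairs.
apply: (IH _ (ctl c) j.+1 _ (Fm (cfst c))) pairs => //.
- by rewrite addSn -addnS.
- by split=> //; exists A, e.
- exact: homTmap_exact.
Qed.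

Lemma Ext_right_orthogonal : mgen M N.
Proof.
have [a [b [f [e [fe esurj]]]]] := homT_presentation N.
have [[Z [f' c]] ang] := angle_exists f.
have /= [ff' [f'c pairs]] := angle_all_pairs ang.
have {}ff' := homTmap_exact (T := T) ff'; have {}f'c := homTmap_exact (T := T) f'c.
(* [N] is the cokernel of [Fm f], so [Fm f'] induces [i] on it, injective by exactness of the
   angle. *)
have [|i iE] := linear_factor_surj (f := Fm f') esurj.
  by move=> x /fe [y <-]; apply: exact_comp ff'.
apply: (add_cores_angle (j := 0) (e := i)) pairs _ => //.
- split=> // y; have [x <-] := esurj y; rewrite iE => /ff' [z <-].
  exact: exact_comp fe.
- move=> y; split=> [/f'c [x <-]|[x <-]]; first by exists (e x).
  by have [z <-] := esurj x; rewrite iE; apply: exact_comp f'c.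
exact: (tilt_hom0 (gen_refl T) (gen_copies T a)).
Qed.

End RightOrthogonal.

(* For S Y isomorphic to T, the resolution of Sg Y yields an injective
   coresolution of Gamma of length d.+1. *)
Lemma gldim_le_pred n : (d < n)%N -> gldim_le (endoAlg T) n.+1 -> gldim_le (endoAlg T) n.
Proof.
move=> dn gl M; have [P Pn] := gl M; apply: syz_dim_proj_dim.
have [Y [t [t' [t't tt']]]] := serre_surj T.
(* Write [S Y] as [Sg B]. Morphisms from [Sg B] to [Sg (S Y)] vanish, hence those from [B] to [S Y],
   by duality those from [Y] to [B], and after suspension those from [Sg Y] to [S Y], which is
   isomorphic to [T]. *)
have ST0 : forall f : hom (Sg Y) T, f = 0.
  have [z _] := tiltT.
  have SYT := isomorphic_retract (ex_intro _ t (ex_intro _ t' (conj t't tt'))).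
  have TSY : retract T (S Y) by exists t', t.
  have [B eB] := susp_surj (S Y).
  have SS0 : forall f : hom (S Y) (Sg (S Y)), f = 0.
    exact: tilt_hom0 (retract_gen TSY) (retract_gen TSY).
  have BS0 : forall f : hom B (S Y), f = 0.
    move=> f; apply: susp_faithful; rewrite susp0.
    by move: (fmap Sg f); rewrite eB; apply: SS0.
  have YB0 := serre_eq0_inv theta_bij BS0.
  move=> f; have [p [i pi]] := SYT; rewrite -[f]comp1m -pi -compA.
  suff -> : i \oc f = 0 by rewrite comp0r.
  move: (i \oc f); rewrite -eB => h; have [h' ->] := susp_full h.
  by rewrite [h']YB0 susp0.
have [W [b [c [gW res pairs surj]]]] := tilt_resolution Y.
have cores : inj_cores M n.+1 (Fm (fmap S b)).
  apply: (tilt_inj_cores_end _ gW res pairs) => //.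
  exact: (serre_eq0 theta_bij ST0).
have mono y : Fm (fmap S b) y = 0 -> y = 0.
  exact: (serre_mono theta_bij theta_natl surj).
have rl : linear (fun a : reg_mod (endoAlg T) => a : F T) by [].
have [m [p [q pq]]] := projective_dual_basis (@pr_projective _ _ _ P n.+1).
(* The resolution is zero beyond degree [n.+1], so each dual basis coordinate [q i] is a cocycle
   with values in [F T], and hence a coboundary. *)
have H i : exists g : {linear pr_obj P n -> F T},
    forall x, q i x = g (pr_diff P n x) :> hom T T.
  have [|g gE] := cocycle_coboundary
      (f := Fm t' \o (mklin rl \o q i) : {linear pr_obj P n.+1 -> F (S Y)}) cores.
    by move=> x; rewrite [x]Pn // !linear0.
  exists (Fm t \o g : {linear _ -> _}) => x.
  have /eqP := gE x; rewrite -subr_eq0 -linearB => /eqP /mono /eqP.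
  rewrite subr_eq0 => /eqP /= e.
  by rewrite /= -e compA tt' comp1m.
pose g i := proj1_sig (constructive_indefinite_description _ (H i)).
have gE i x : q i x = g i (pr_diff P n x) :> hom T T.
  by rewrite /g; case: constructive_indefinite_description.
(* The dual basis assembles the [g i] into a retraction of the top differential. *)
have hl : linear (fun x : pr_obj P n => \sum_i (g i x : (endoAlg T)^c) *: p i).
  move=> a x y; rewrite scaler_sumr -big_split; apply: eq_bigr => i _.
  by rewrite linearP /= scalerA -scalerDl.
apply: (split_top_syz_dim (g := mklin hl)) => x.
rewrite [RHS]pq; apply: eq_bigr => i _; congr (_ *: _).
exact: esym (gE i x).
Qed.

End ClusterTilting.

Lemma proj_dim_le_mono (k : fieldType) (A : fdAlgebra k) (M : fdmod A) m n :
  (m <= n)%N -> proj_dim_le m M -> proj_dim_le n M.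
Proof. by move=> mn [P Pm]; exists P => i ni; apply: Pm; apply: leq_ltn_trans ni. Qed.

Theorem corollary0p7 (k : closedFieldType) (d : nat) (C : angCat k d)
    (S : functor C C) (T : C) :
  (1 <= d)%N ->
  idempotents_split C ->
  serre_functor S ->
  cluster_tilting T ->
  finitely_many_indecomposables C ->
  weakly_rep_finite (endoAlg T) d /\
  (gldim_finite (endoAlg T) -> rep_finite (endoAlg T) d).
Proof.
case: d C S T => [//|d] C S T _ _ [[G [_ [eps [epsiso _]]]] [theta [tb tl tr]]] tilt.
move=> /finite_type_gen [X0 genX0].
have ssurj Y : exists Y', isomorphic (S Y') Y.
  by exists (G Y), (eps Y).
have wrf : weakly_rep_finite (endoAlg T) d.+1.
  (* Every object lies in the add of [X0], so every [homTmod T X] lies in the add of [M]. *)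
  pose M := homTmod T X0.
  have ext U V i : mgen M U -> mgen M V -> (1 <= i <= d)%N -> Ext_eq0 i U V.
    exact: (homT_Ext_eq0 tilt tb tl tr ssurj).
  have genM X : mgen M (homTmod T X) := gen_mgen T (genX0 X).
  exists M; rewrite /cluster_tilting_module; split.
  - have [cf vf] := mgen_functorially_finite M.
    split=> N; [have [U [f [mU fP]]] := cf N|have [U [f [mU fP]]] := vf N].
      by exists U, f; split=> [|V g /mgenP]; [apply/mgenP|apply: fP].
    by exists U, f; split=> [|V g /mgenP]; [apply/mgenP|apply: fP].
  - move=> N; rewrite subn1; split=> [/mgenP mN D i /mgenP mD|extN]; first exact: ext.
    apply/mgenP; have [|X mX] := @Ext_left_orthogonal _ _ _ _ tilt _ _ tb tl tr N.
      by move=> X i; apply: extN; apply/mgenP.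
    exact: mgen_trans (genM X) mX.
  - move=> N; rewrite subn1; split=> [/mgenP mN D i /mgenP mD|extN]; first exact: ext.
    apply/mgenP; apply: (Ext_right_orthogonal tilt genM) => // D i mD.
    by apply: extN; apply/mgenP.
split=> // -[n gl]; split=> //.
have [nd|dn] := leqP n d.+1; first by move=> M; apply: proj_dim_le_mono (gl M).
(* The bound on the global dimension drops by one at a time until it reaches [d.+1]. *)
elim: n gl dn => // n IH gl; rewrite ltnS => dn.
have {}gl := gldim_le_pred tilt tb tl tr ssurj dn gl.
by move: dn; rewrite leq_eqVlt => /predU1P [e|/(IH gl)] //; subst n.
Qed.
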